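(* Let $\phi:\mathbb{R}\to\mathbb{C}$ be defined by $\phi(t)=\sum_{k\in\mathbb{Z}}\frac{e^{-4\pi^2 i k^2 t}-1}{-4\pi^2k^2}$, where the term $k=0$ is understood as its limiting value $it$. For $\sigma\ge 0$ let $D_\sigma=\{x\in\mathbb{R} : \alpha_\phi(x)=\sigma\}$. Then for every $\alpha\in[1/2,3/4]$, \[\dim_{\mathcal H}\phi(D_\alpha)\le \dim_{\mathcal H}\phi\Big(\bigcup_{\sigma\le\alpha}D_\sigma\Big)\le \frac{4\alpha-2}{\alpha}.\]
   Context: For $\beta\ge0$ and $x_0\in\mathbb{R}$, a function $f:\mathbb{R}\to\mathbb{C}$ is in $C^\beta(x_0)$ if there exist a polynomial $P$ (complex coefficients) with $\deg P\le\beta$ and a constant $C>0$ such that $|f(x_0+h)-P(h)|\le C|h|^\beta$ for all sufficiently small $|h|$. The Hölder exponent of $f$ at $x_0$ is $\alpha_f(x_0)=\sup\{\beta\ge0 : f\in C^\beta(x_0)\}$. $\dim_{\mathcal H}$ denotes Hausdorff dimension in $\mathbb{C}\cong\mathbb{R}^2$. *)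

(* Defs.v *)
From Stdlib Require Import Reals ZArith.
From Coquelicot Require Import Coquelicot.
Open Scope R_scope.

(* k-th term, k <> 0:  (e^{-4 pi^2 i k^2 t} - 1) / (-4 pi^2 k^2),
   written with e^{-i th} = cos th - i sin th, th = 4 pi^2 k^2 t. *)
Definition phi_term (k : Z) (t : R) : C :=
  let a := 4 * PI ^ 2 * (IZR k) ^ 2 in
  RtoC (/ (- a)) * (Cminus (cos (a * t), - sin (a * t)) (RtoC 1)).

(* sum over k in Z, the k = 0 term being its limiting value i t;
   the sum over Z \ {0} is taken as the (absolutely convergent) series
   over n >= 1 of the terms k = n and k = -n, componentwise. *)
Definition phi_pair (n : nat) (t : R) : C :=
  Cplus (phi_term (Z.of_nat (S n)) t) (phi_term (- Z.of_nat (S n))%Z t).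

Definition phi (t : R) : C :=
  Cplus (0, t) (Series (fun n => fst (phi_pair n t)),
                Series (fun n => snd (phi_pair n t))).

(* x^b for x >= 0 and b >= 0, with 0^0 = 1 and 0^b = 0 for b > 0 *)
Definition rpow (x b : R) : R :=
  if Rlt_dec 0 x then Rpower x b
  else if Req_EM_T b 0 then 1 else 0.

Fixpoint cpoly (c : nat -> C) (n : nat) (h : R) : C :=
  match n with
  | O => c O
  | S m => Cplus (cpoly c m h) (Cmult (c (S m)) (RtoC (h ^ S m)))
  end.

Definition holder_at (f : R -> C) (x0 beta : R) : Prop :=
  exists (n : nat) (c : nat -> C) (K delta : R),
    INR n <= beta /\ 0 < K /\ 0 < delta /\
    forall h : R, Rabs h < delta ->
      Cmod (Cminus (f (x0 + h)) (cpoly c n h)) <= K * rpow (Rabs h) beta.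

Definition holder_exponent (f : R -> C) (x0 : R) : Rbar :=
  Lub_Rbar (fun beta => 0 <= beta /\ holder_at f x0 beta).

(* diameter of a set (0 for the empty set; meaningful for bounded sets) *)
Definition diam (U : C -> Prop) : R :=
  real (Lub_Rbar (fun r => r = 0 \/ exists x y, U x /\ U y /\ r = Cmod (Cminus x y))).

Definition bounded_by (U : C -> Prop) (delta : R) : Prop :=
  forall x y, U x -> U y -> Cmod (Cminus x y) <= delta.

Definition diam_pow (U : C -> Prop) (s : R) : R :=
  if Rlt_dec 0 (diam U) then Rpower (diam U) s else 0.

Definition hausdorff_pre (s delta : R) (A : C -> Prop) : Rbar :=
  Glb_Rbar (fun r => exists U : nat -> (C -> Prop),
    (forall i, bounded_by (U i) delta) /\
    (forall z, A z -> exists i, U i z) /\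
    is_series (fun i => diam_pow (U i) s) r).

(* H^s(A) = lim_{delta -> 0} H^s_delta(A) = sup over delta = 1/(n+1) *)
Definition hausdorff_measure (s : R) (A : C -> Prop) : Rbar :=
  Sup_seq (fun n => hausdorff_pre s (/ INR (S n)) A).

Definition hausdorff_dim (A : C -> Prop) : Rbar :=
  Glb_Rbar (fun s => 0 < s /\ hausdorff_measure s A = Finite 0).

Definition image (f : R -> C) (D : R -> Prop) : C -> Prop :=
  fun z => exists x, D x /\ f x = z.

Definition D_level (sigma : R) : R -> Prop :=
  fun x => holder_exponent phi x = Finite sigma.

Definition D_below (alpha : R) : R -> Prop :=
  fun x => exists sigma, 0 <= sigma /\ sigma <= alpha /\ D_level sigma x.

(* Main.v *)
Require Import Defs.
From Stdlib Require Import Reals ZArith Lra Lia List FinFun Cantor.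
From Stdlib Require Import Classical IndefiniteDescription.
From Coquelicot Require Import Coquelicot.
Open Scope R_scope.

(* Put [y = 2 PI t], so that [phi] is, up to a linear term, a multiple of the sum over [k >= 1] of
   [(e^(-2 PI i k^2 y) - 1) / k^2].  Everything follows from Weyl's inequality for the
   quadratic sums [S_n(y)], the sum of [e^(2 PI i k^2 y)] over [1 <= k <= n]: if [p / q] is reduced
   and [|y - p / q| <= 1 / q^2], then [|S_n(y)|^2 << q^e (n^2 / q + n + q)].  An increment of [phi]
   over [[y, y + h]] is controlled by the [S_n(x)] with [n >= |h|^(-1/2)] and [x] in that interval:
   use the mean value theorem on the frequencies [k <= |h|^(-1/2)] and summation by parts on
   the others.  This has two consequences.

   - Around a reduced [p / q], and for [|h| <= 1 / q^2], the increment is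
     [<< q^(-1/2) |h|^(1/2 - e/2)].
   - If [|y - p / q| >= c q^(-mu)] for all reduced [p / q], with [mu >= 2], then Dirichlet's theorem
     provides good denominators at every scale and the increments at [y] are
     [<< |h|^(1/2 + 1/(2 mu) - e/2)].

   By the second one, a point with Holder exponent [<= alpha < 1/2 + 1/(2 mu)] is rational or lies
   within [q^(-mu)] of infinitely many reduced [p / q] (for [alpha = 3/4] Dirichlet's theorem gives
   this with [mu = 2]).  By the first one the images of those neighbourhoods have diameter
   [<< q^(-(1 + mu)/2 + mu e/2)]; as there are about [q] of them per unit interval, the
   Hausdorff-Cantelli lemma makes the measure of exponent [s] vanish as soon as [s (1 + mu) > 4],
   and [4 / (1 + mu)] tends to [(4 alpha - 2) / alpha] when [mu] tends to [1 / (2 alpha - 1)]. *)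

(** * Finite sums *)

Definition sum_list {T : Type} (f : T -> R) (l : list T) : R := fold_right Rplus 0 (map f l).

Lemma sum_list_cons {T : Type} (f : T -> R) (x : T) (l : list T) :
  sum_list f (x :: l) = f x + sum_list f l.
Proof. reflexivity. Qed.

Lemma sum_list_app {T : Type} (f : T -> R) (l1 l2 : list T) :
  sum_list f (l1 ++ l2) = sum_list f l1 + sum_list f l2.
Proof.
  unfold sum_list; induction l1 as [|x l1 IH]; simpl; [ring|]. rewrite IH; ring.
Qed.

Lemma sum_list_map {S T : Type} (f : T -> R) (g : S -> T) (l : list S) :
  sum_list f (map g l) = sum_list (fun x => f (g x)) l.
Proof. unfold sum_list; now rewrite map_map. Qed.

Lemma sum_list_ext {T : Type} (f g : T -> R) (l : list T) :
  (forall x, In x l -> f x = g x) -> sum_list f l = sum_list g l.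
Proof. intros fg; unfold sum_list; now rewrite (map_ext_in _ _ _ fg). Qed.

Lemma sum_list_plus {T : Type} (f g : T -> R) (l : list T) :
  sum_list (fun x => f x + g x) l = sum_list f l + sum_list g l.
Proof. unfold sum_list; induction l as [|x l IH]; simpl; [ring|]. rewrite IH; ring. Qed.

Lemma sum_list_scal {T : Type} (c : R) (f : T -> R) (l : list T) :
  sum_list (fun x => c * f x) l = c * sum_list f l.
Proof. unfold sum_list; induction l as [|x l IH]; simpl; [ring|]. rewrite IH; ring. Qed.

Lemma sum_list_const {T : Type} (c : R) (l : list T) :
  sum_list (fun _ => c) l = INR (length l) * c.
Proof.
  unfold sum_list; induction l as [|x l IH]; [simpl; ring|].
  cbn [map fold_right length]; rewrite S_INR, IH; ring.
Qed.

Lemma sum_list_le {T : Type} (f g : T -> R) (l : list T) :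
  (forall x, In x l -> f x <= g x) -> sum_list f l <= sum_list g l.
Proof.
  unfold sum_list; induction l as [|x l IH]; intros fg; simpl; [lra|].
  apply Rplus_le_compat; [|apply IH; intros]; apply fg; simpl; auto.
Qed.

Lemma sum_list_ge0 {T : Type} (f : T -> R) (l : list T) :
  (forall x, 0 <= f x) -> 0 <= sum_list f l.
Proof.
  intros f_ge0. rewrite <- (Rmult_0_r (INR (length l))), <- sum_list_const.
  apply sum_list_le; auto.
Qed.

Lemma Rabs_sum_list {T : Type} (f : T -> R) (l : list T) :
  Rabs (sum_list f l) <= sum_list (fun x => Rabs (f x)) l.
Proof.
  unfold sum_list; induction l as [|x l IH]; simpl; [rewrite Rabs_R0; lra|].
  eapply Rle_trans; [apply Rabs_triang|]; lra.
Qed.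

Lemma sum_list_incl {T : Type} (f : T -> R) (l l' : list T) :
  (forall x, 0 <= f x) -> NoDup l -> incl l l' -> sum_list f l <= sum_list f l'.
Proof.
  intros f_ge0; revert l'; induction l as [|x l IH]; intros l' l_nodup l_incl.
  { now apply sum_list_ge0. }
  inversion l_nodup as [|? ? x_notin l_nodup']; subst.
  destruct (in_split x l' (l_incl x (or_introl eq_refl))) as (l1 & l2 & ->).
  assert (split_x : sum_list f (l1 ++ x :: l2) = f x + sum_list f (l1 ++ l2)).
  { rewrite !sum_list_app, sum_list_cons; ring. }
  rewrite split_x; apply Rplus_le_compat_l, IH; [exact l_nodup'|].
  intros z z_in. specialize (l_incl z (or_intror z_in)).
  apply in_app_or in l_incl; apply in_or_app; simpl in l_incl.
  destruct l_incl as [?|[?|?]]; auto. subst; contradiction.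
Qed.

Lemma sum_list_prod {S T : Type} (f : S * T -> R) (l : list S) (l' : list T) :
  sum_list f (list_prod l l') = sum_list (fun x => sum_list (fun y => f (x, y)) l') l.
Proof.
  induction l as [|x l IH]; [reflexivity|].
  simpl list_prod; now rewrite sum_list_app, sum_list_map, sum_list_cons, IH.
Qed.

Lemma sum_list_seq_S (f : nat -> R) (a n : nat) :
  sum_list f (seq a (S n)) = sum_list f (seq a n) + f (a + n)%nat.
Proof. rewrite seq_S, sum_list_app; unfold sum_list; simpl; ring. Qed.

Lemma sum_list_seq_shift (f : nat -> R) (a n : nat) :
  sum_list f (seq (S a) n) = sum_list (fun k => f (S k)) (seq a n).
Proof. now rewrite <- seq_shift, sum_list_map. Qed.

Lemma sum_list_seq_rev (f : nat -> R) (a n : nat) :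
  sum_list (fun k => f (a + a + n - 1 - k)%nat) (seq a n) = sum_list f (seq a n).
Proof.
  induction n as [|n IH]; [reflexivity|].
  rewrite (sum_list_seq_S f), <- IH, Rplus_comm.
  cbn [seq]; rewrite sum_list_cons, sum_list_seq_shift; f_equal; [f_equal; lia|].
  apply sum_list_ext; intros k _; f_equal; lia.
Qed.

Lemma map_add_seq (a b n : nat) : map (fun k => a + k)%nat (seq b n) = seq (a + b) n.
Proof.
  revert b; induction n as [|n IH]; intros b; [reflexivity|].
  cbn [seq map]; now rewrite IH, Nat.add_succ_r.
Qed.

Lemma sum_n_sum_list (f : nat -> R) (n : nat) : sum_n f n = sum_list f (seq 0 (S n)).
Proof.
  induction n as [|n IH]; [rewrite sum_O; unfold sum_list; simpl; ring|].
  rewrite sum_Sn, IH, (sum_list_seq_S f 0 (S n)); reflexivity.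
Qed.

Lemma sum_list_Cantor_le (f : nat -> nat -> R) (g : nat -> R) (E : R) :
  (forall i j, 0 <= f i j) ->
  (forall i n, sum_list (f i) (seq 0 n) <= g i) ->
  (forall n, sum_list g (seq 0 n) <= E) ->
  forall n, sum_list (fun k => f (fst (Cantor.of_nat k)) (snd (Cantor.of_nat k))) (seq 0 n) <= E.
Proof.
  intros f_ge0 row_le col_le n.
  rewrite <- (sum_list_map (fun ij => f (fst ij) (snd ij)) Cantor.of_nat).
  apply Rle_trans with
    (sum_list (fun ij => f (fst ij) (snd ij)) (list_prod (seq 0 n) (seq 0 n))).
  - apply sum_list_incl; [intros; apply f_ge0| |].
    + apply Injective_map_NoDup; [|apply seq_NoDup].
      intros k k' eq_kk'. rewrite <- (Cantor.cancel_to_of k), eq_kk'; apply Cantor.cancel_to_of.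
    + intros [i j] ij_in; apply in_map_iff in ij_in; destruct ij_in as (k & code_k & k_in).
      apply in_seq in k_in.
      assert (k = Cantor.to_nat (i, j)) by (rewrite <- code_k; now rewrite Cantor.cancel_to_of).
      pose proof (Cantor.to_nat_non_decreasing i j).
      apply in_prod; apply in_seq; lia.
  - rewrite sum_list_prod. eapply Rle_trans; [|apply (col_le n)].
    apply sum_list_le; intros i _; exact (row_le i n).
Qed.

Lemma sum_list_seq_ltb_le (D : R) (m n : nat) : 0 <= D ->
  sum_list (fun i => if i <? m then D else 0) (seq 0 n) <= INR m * D.
Proof.
  intros D_ge0.
  assert (closed_form : sum_list (fun i => if i <? m then D else 0) (seq 0 n) = INR (min n m) * D).
  { induction n as [|n IH]; [unfold sum_list; simpl; ring|].
    rewrite sum_list_seq_S, IH; simpl (0 + n)%nat.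
    destruct (Nat.ltb_spec n m).
    - rewrite !Nat.min_l, S_INR by lia; ring.
    - rewrite !Nat.min_r by lia; ring. }
  rewrite closed_form; apply Rmult_le_compat_r; [exact D_ge0|apply le_INR; lia].
Qed.

Lemma is_derive_sum_list {T : Type} (f : T -> R -> R) (df : T -> R) (l : list T) (x : R) :
  (forall k, In k l -> is_derive (f k) x (df k)) ->
  is_derive (fun y => sum_list (fun k => f k y) l) x (sum_list df l).
Proof.
  unfold sum_list; induction l as [|k l IH]; intros f_der; simpl.
  - apply (is_derive_const (K := R_AbsRing) 0 x).
  - apply (is_derive_plus (f k) (fun y => fold_right Rplus 0 (map (fun k => f k y) l)));
      [|apply IH; intros]; apply f_der; simpl; auto.
Qed.

(** * Dirichlet's approximation theorem *)

Definition reduced (p : Z) (q : nat) : Prop := (0 < q)%nat /\ Z.gcd p (Z.of_nat q) = 1%Z.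

Lemma INR_ge1 (n : nat) : (0 < n)%nat -> 1 <= INR n.
Proof. exact (le_INR 1 n). Qed.

Lemma reduced_INR_ge1 (p : Z) (q : nat) : reduced p q -> 1 <= INR q.
Proof. intros [q_pos _]; now apply INR_ge1. Qed.

Lemma Rabs_minus_fraction (y p q : R) : 0 < q -> Rabs (y - p / q) = Rabs (y * q - p) / q.
Proof.
  intros q_pos. rewrite <- (Rabs_pos_eq q) at 3 by lra. rewrite <- Rabs_div by lra.
  f_equal; field; lra.
Qed.

(* Consecutive Farey fractions enclose [y]; [b c - a d = 1] gives coprimality for free. *)
Lemma farey_neighbours (y : R) (n : nat) : (0 < n)%nat ->
  exists (a c : Z) (b d : nat), (0 < b <= n)%nat /\ (0 < d <= n)%nat /\ (n < b + d)%nat /\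
    (Z.of_nat b * c - a * Z.of_nat d = 1)%Z /\ IZR a <= y * INR b /\ y * INR d <= IZR c.
Proof.
  intros n_pos; induction n_pos as
    [|n n_pos (a & c & b & d & b_le & d_le & large & det & lower & upper)].
  - exists (Int_part y), (Int_part y + 1)%Z, 1%nat, 1%nat.
    destruct (base_Int_part y); rewrite plus_IZR; change (INR 1) with 1.
    repeat split; try lia; lra.
  - destruct (le_lt_dec (b + d) (S n)) as [mediant_le|mediant_gt].
    2: { exists a, c, b, d; repeat split; try lia; assumption. }
    destruct (Rle_lt_dec (IZR (a + c)) (y * INR (b + d))) as [below|above].
    + exists (a + c)%Z, c, (b + d)%nat, d; repeat split; try lia; assumption.
    + exists a, (a + c)%Z, b, (b + d)%nat; repeat split; try lia; lra.
Qed.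

Lemma dirichlet (y X : R) : 1 <= X ->
  exists (p : Z) (q : nat), reduced p q /\ INR q <= X /\
    Rabs (y - IZR p / INR q) <= / (INR q * X).
Proof.
  intros X_ge1.
  destruct (nfloor_ex X ltac:(lra)) as [n [n_le n_gt]].
  assert (n_pos : (0 < n)%nat) by (destruct n; [simpl in n_gt; lra | lia]).
  destruct (farey_neighbours y n n_pos)
    as (a & c & b & d & b_le & d_le & large & det & lower & upper).
  assert (X_le : X <= INR b + INR d).
  { apply Rle_trans with (INR (S n)); [rewrite S_INR; lra|].
    rewrite <- plus_INR; apply le_INR; lia. }
  assert (detR : INR b * IZR c - IZR a * INR d = 1).
  { rewrite !INR_IZR_INZ, <- !mult_IZR, <- minus_IZR; now rewrite det. }
  assert (b_pos : 0 < INR b) by (apply lt_0_INR; lia).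
  assert (d_pos : 0 < INR d) by (apply lt_0_INR; lia).
  assert (INR b <= INR n) by (apply le_INR; lia).
  assert (INR d <= INR n) by (apply le_INR; lia).
  assert (to_fraction : forall (p : Z) (q : nat), 0 < INR q -> Rabs (y * INR q - IZR p) * X <= 1 ->
    Rabs (y - IZR p / INR q) <= / (INR q * X)).
  { intros p q q_pos close. rewrite Rabs_minus_fraction by exact q_pos.
    apply Rle_div_l; [exact q_pos|].
    replace (/ (INR q * X) * INR q) with (1 / X) by (field; lra).
    apply Rle_div_r; lra. }
  destruct (Rle_lt_dec (y * (INR b + INR d)) (IZR a + IZR c)) as [below|above].
  - exists a, b; split; [|split; [lra|]].
    + split; [lia|]. apply Z.bezout_1_gcd. exists (- Z.of_nat d)%Z, c. lia.
    + apply to_fraction; [exact b_pos|]. rewrite Rabs_pos_eq by lra.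
      apply Rle_trans with ((y * INR b - IZR a) * (INR b + INR d)); nra.
  - exists c, d; split; [|split; [lra|]].
    + split; [lia|]. apply Z.bezout_1_gcd. exists (Z.of_nat b), (- a)%Z. lia.
    + apply to_fraction; [exact d_pos|]. rewrite Rabs_left1 by lra.
      apply Rle_trans with (- (y * INR d - IZR c) * (INR b + INR d)); nra.
Qed.

(** * Real powers and sums of powers *)

Lemma Rpower_pos (x a : R) : 0 < Rpower x a.
Proof. apply exp_pos. Qed.

Lemma Rpower_1_l (a : R) : Rpower 1 a = 1.
Proof. unfold Rpower; rewrite ln_1, Rmult_0_r; apply exp_0. Qed.

Lemma Rpower_inv_base (x a : R) : 0 < x -> Rpower (/ x) a = Rpower x (- a).
Proof. intros; unfold Rpower; rewrite ln_Rinv by assumption; f_equal; ring. Qed.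

Lemma Rpower_decr_exponent (x a b : R) : 0 < x <= 1 -> a <= b -> Rpower x b <= Rpower x a.
Proof.
  intros x_bounds a_le_b. rewrite <- (Rinv_inv x), !(Rpower_inv_base (/ x))
    by (apply Rinv_0_lt_compat; lra).
  apply Rle_Rpower; [|lra]. rewrite <- Rinv_1; apply Rinv_le_contravar; lra.
Qed.

Lemma Rpower_decr_base (x y a : R) : a <= 0 -> 0 < x <= y -> Rpower y a <= Rpower x a.
Proof.
  intros a_le0 x_le_y. replace a with (- - a) by ring. rewrite !(Rpower_Ropp _ (- a)).
  apply Rinv_le_contravar; [apply Rpower_pos|apply Rle_Rpower_l; lra].
Qed.

Lemma Rpower_le1 (x a : R) : 0 < x <= 1 -> 0 <= a -> Rpower x a <= 1.
Proof. intros; rewrite <- (Rpower_O x) by lra. now apply Rpower_decr_exponent. Qed.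

Lemma Rpower_sqr (x a : R) : Rpower x a ^ 2 = Rpower x (2 * a).
Proof. simpl; rewrite Rmult_1_r, <- Rpower_plus; f_equal; ring. Qed.

Lemma Rpower_neg_INR (x : R) (n : nat) : 0 < x -> Rpower x (- INR n) = / x ^ n.
Proof. intros; now rewrite Rpower_Ropp, Rpower_pow. Qed.

Lemma Rpower_step_le (x tau : R) : 0 < x -> 0 < tau ->
  Rpower (x + 1) (- 1 - tau) <= / tau * (Rpower x (- tau) - Rpower (x + 1) (- tau)).
Proof.
  intros x_pos tau_pos.
  assert (log_step : / (x + 1) <= ln (x + 1) - ln x).
  { pose proof (exp_ineq1_le (ln (x / (x + 1)))) as log_le.
    rewrite exp_ln, ln_div in log_le by (try apply Rdiv_lt_0_compat; lra).
    replace (x / (x + 1)) with (1 - / (x + 1)) in log_le by (field; lra). lra. }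
  assert (ratio : Rpower x (- tau) = Rpower (x + 1) (- tau) * exp (tau * (ln (x + 1) - ln x))).
  { unfold Rpower; rewrite <- exp_plus; f_equal; ring. }
  pose proof (exp_ineq1_le (tau * (ln (x + 1) - ln x))).
  assert (tau * / (x + 1) <= exp (tau * (ln (x + 1) - ln x)) - 1) by nra.
  pose proof (Rpower_pos (x + 1) (- tau)).
  replace (- 1 - tau) with (- tau + - (1)) by ring.
  rewrite Rpower_plus, (Rpower_Ropp _ 1), Rpower_1, ratio by lra.
  apply Rmult_le_reg_l with tau; [lra|].
  rewrite <- (Rmult_assoc tau (/ tau)), Rinv_r by lra. nra.
Qed.

Lemma sum_Rpower_tail_le (tau : R) (m n : nat) : 0 < tau -> (0 < m)%nat ->
  sum_list (fun k => Rpower (INR k) (- 1 - tau)) (seq (S m) n) <= / tau * Rpower (INR m) (- tau).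
Proof.
  intros tau_pos m_pos.
  assert (telescoped : sum_list (fun k => Rpower (INR k) (- 1 - tau)) (seq (S m) n)
    <= / tau * (Rpower (INR m) (- tau) - Rpower (INR (m + n)) (- tau))).
  { induction n as [|n IH].
    - rewrite Nat.add_0_r; unfold sum_list; simpl; lra.
    - rewrite sum_list_seq_S, Nat.add_succ_r; simpl (S m + n)%nat.
      assert (pos : 0 < INR (m + n)) by (apply lt_0_INR; lia).
      pose proof (Rpower_step_le _ tau pos tau_pos) as step.
      rewrite <- S_INR in step. lra. }
  pose proof (Rpower_pos (INR (m + n)) (- tau)).
  assert (0 < / tau) by now apply Rinv_0_lt_compat.
  nra.
Qed.

Lemma sum_Rpower_le (tau : R) (n : nat) : 0 < tau ->
  sum_list (fun k => Rpower (INR k) (- 1 - tau)) (seq 1 n) <= 1 + / tau.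
Proof.
  intros tau_pos. assert (0 < / tau) by now apply Rinv_0_lt_compat.
  destruct n as [|n]; [unfold sum_list; simpl; lra|].
  pose proof (sum_Rpower_tail_le tau 1 n tau_pos ltac:(lia)) as tail_le.
  change (INR 1) with 1 in tail_le; rewrite Rpower_1_l in tail_le.
  cbn [seq]; rewrite sum_list_cons. change (INR 1) with 1; rewrite Rpower_1_l. lra.
Qed.

Lemma ex_series_bounded (a : nat -> R) (B : R) :
  (forall n, 0 <= a n) -> (forall n, sum_list a (seq 0 n) <= B) -> ex_series a.
Proof.
  intros a_ge0 sums_le. destruct (ex_finite_lim_seq_incr (sum_n a) B) as [l l_lim].
  - intros n; rewrite sum_Sn; change plus with Rplus; specialize (a_ge0 (S n)); lra.
  - intros n; rewrite sum_n_sum_list; apply sums_le.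
  - exists l; exact l_lim.
Qed.

Lemma ex_series_Rpower (tau : R) : 0 < tau -> ex_series (fun n => Rpower (INR (S n)) (- 1 - tau)).
Proof.
  intros tau_pos. apply ex_series_bounded with (1 + / tau).
  - intros n; left; apply Rpower_pos.
  - intros n; rewrite <- (sum_list_seq_shift (fun k => Rpower (INR k) (- 1 - tau))).
    now apply sum_Rpower_le.
Qed.

Definition harmonic (n : nat) : R := sum_list (fun k => / INR k) (seq 1 n).

Lemma harmonic_ge1 (n : nat) : (0 < n)%nat -> 1 <= harmonic n.
Proof.
  intros n_pos. destruct n as [|n]; [lia|].
  assert (0 <= sum_list (fun k => / INR (S k)) (seq 1 n)).
  { apply sum_list_ge0; intros k; left; apply Rinv_0_lt_compat, lt_0_INR; lia. }
  unfold harmonic; cbn [seq]; rewrite sum_list_cons, sum_list_seq_shift.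
  change (INR 1) with 1. lra.
Qed.

Lemma harmonic_le_Rpower (e : R) (n : nat) : 0 < e ->
  harmonic n <= (1 + / e) * Rpower (INR n) e.
Proof.
  intros e_pos. rewrite Rmult_comm.
  apply Rle_trans with
    (Rpower (INR n) e * sum_list (fun k => Rpower (INR k) (- 1 - e)) (seq 1 n)).
  - rewrite <- sum_list_scal. apply sum_list_le; intros k k_in; apply in_seq in k_in.
    assert (k_pos : 0 < INR k) by (apply lt_0_INR; lia).
    assert (INR k <= INR n) by (apply le_INR; lia).
    replace (/ INR k) with (Rpower (INR k) e * Rpower (INR k) (- 1 - e)).
    2: { rewrite <- Rpower_plus. replace (e + (- 1 - e)) with (- (1)) by ring.
      now rewrite Rpower_Ropp, Rpower_1. }
    apply Rmult_le_compat_r; [left; apply Rpower_pos|apply Rle_Rpower_l; lra].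
  - apply Rmult_le_compat_l; [left; apply Rpower_pos|now apply sum_Rpower_le].
Qed.

(** * Weyl's inequality *)

Definition expsum_sq (theta : nat -> R) (n : nat) : R :=
  sum_list (fun k => cos (theta k)) (seq 1 n) ^ 2 + sum_list (fun k => sin (theta k)) (seq 1 n) ^ 2.

Lemma sum_cos_minus (theta : nat -> R) (c : R) (l : list nat) :
  sum_list (fun k => cos (c - theta k)) l
    = cos c * sum_list (fun k => cos (theta k)) l + sin c * sum_list (fun k => sin (theta k)) l.
Proof.
  rewrite <- !sum_list_scal, <- sum_list_plus.
  apply sum_list_ext; intros; apply cos_minus.
Qed.

Lemma sum_cos_plus_sq_le (theta : nat -> R) (c : R) (n : nat) :
  sum_list (fun k => cos (theta k + c)) (seq 1 n) ^ 2 <= expsum_sq theta n.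
Proof.
  rewrite (sum_list_ext _ (fun k => cos (- c - theta k))).
  2: { intros k _; rewrite <- cos_neg; f_equal; ring. }
  rewrite sum_cos_minus, cos_neg, sin_neg. unfold expsum_sq.
  set (A := sum_list _ _). set (B := sum_list _ _).
  assert (0 <= (sin c * A + cos c * B) ^ 2) by apply pow2_ge_0.
  pose proof (sin2_cos2 c) as pythagoras; unfold Rsqr in pythagoras.
  replace (A ^ 2 + B ^ 2) with ((sin c * sin c + cos c * cos c) * (A ^ 2 + B ^ 2))
    by (rewrite pythagoras; ring).
  nra.
Qed.

Lemma expsum_sq_S (theta : nat -> R) (n : nat) :
  expsum_sq theta (S n)
    = expsum_sq theta n + 1 + 2 * sum_list (fun k => cos (theta (S n) - theta k)) (seq 1 n).
Proof.
  rewrite sum_cos_minus. unfold expsum_sq; rewrite !sum_list_seq_S; simpl (1 + n)%nat.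
  pose proof (sin2_cos2 (theta (S n))) as pythagoras; unfold Rsqr in pythagoras.
  rewrite <- pythagoras; ring.
Qed.

Lemma expsum_sq_differencing (theta : nat -> R) (n : nat) :
  expsum_sq theta n = INR n
    + 2 * sum_list (fun l => sum_list (fun k => cos (theta (k + l)%nat - theta k)) (seq 1 (n - l)))
        (seq 1 n).
Proof.
  induction n as [|n IH]; [unfold expsum_sq, sum_list; simpl; ring|].
  assert (correlations_S :
    sum_list (fun l => sum_list (fun k => cos (theta (k + l)%nat - theta k)) (seq 1 (S n - l)))
        (seq 1 (S n))
    = sum_list (fun l => sum_list (fun k => cos (theta (k + l)%nat - theta k)) (seq 1 (n - l)))
        (seq 1 n)
      + sum_list (fun k => cos (theta (S n) - theta k)) (seq 1 n)).
  { rewrite sum_list_seq_S, Nat.sub_diag; change (sum_list ?f (seq 1 0)) with 0.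
    rewrite <- (sum_list_seq_rev (fun k => cos (theta (S n) - theta k))).
    rewrite <- sum_list_plus, Rplus_0_r.
    apply sum_list_ext; intros l l_in; apply in_seq in l_in.
    replace (S n - l)%nat with (S (n - l)) by lia. rewrite sum_list_seq_S.
    replace (1 + 1 + n - 1 - l)%nat with (1 + (n - l))%nat by lia.
    now replace (1 + (n - l) + l)%nat with (S n) by lia. }
  rewrite expsum_sq_S, correlations_S, IH, S_INR; ring.
Qed.

Lemma sum_cos_le_length (f : nat -> R) (l : list nat) :
  Rabs (sum_list (fun k => cos (f k)) l) <= INR (length l).
Proof.
  eapply Rle_trans; [apply Rabs_sum_list|].
  rewrite <- (Rmult_1_r (INR (length l))), <- sum_list_const.
  apply sum_list_le; intros k _; apply Rabs_le, COS_bound.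
Qed.

Lemma sum_cos_progression_le (w c : R) (n : nat) :
  Rabs (sum_list (fun k => cos (w * INR k + c)) (seq 1 n)) * Rabs (sin (w / 2)) <= 1.
Proof.
  rewrite <- Rabs_mult.
  assert (telescoped : 2 * (sum_list (fun k => cos (w * INR k + c)) (seq 1 n) * sin (w / 2))
    = sin (w * INR n + c + w / 2) - sin (c + w / 2)).
  { induction n as [|n IH].
    - unfold sum_list; simpl. replace (w * 0 + c + w / 2) with (c + w / 2) by ring. ring.
    - rewrite sum_list_seq_S, Rmult_plus_distr_r, Rmult_plus_distr_l, IH.
      simpl (1 + n)%nat.
      replace (w * INR n + c + w / 2) with (w * INR (S n) + c - w / 2) by (rewrite S_INR; field).
      rewrite (sin_plus (w * INR (S n) + c)), (sin_minus (w * INR (S n) + c)). ring. }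
  pose proof (SIN_bound (w * INR n + c + w / 2)). pose proof (SIN_bound (c + w / 2)).
  apply Rabs_le; lra.
Qed.

(* A substitute for [min (N, 1 / |sin x|)] without case distinction where [sin x = 0]. *)
Definition sin_majorant (N x : R) : R := / (Rabs (sin x) + / N).

Lemma sin_majorant_pos (N x : R) : 0 < N -> 0 < sin_majorant N x.
Proof.
  intros; apply Rinv_0_lt_compat, Rplus_le_lt_0_compat;
    [apply Rabs_pos|now apply Rinv_0_lt_compat].
Qed.

Lemma sin_majorant_le (N x : R) : 0 < N -> sin_majorant N x <= N.
Proof.
  intros N_pos. rewrite <- (Rinv_inv N) at 2.
  apply Rinv_le_contravar; [now apply Rinv_0_lt_compat|].
  pose proof (Rabs_pos (sin x)); lra.
Qed.

Lemma sin_majorant_le_inv (N x v : R) : 0 < N -> 0 < v <= Rabs (sin x) -> sin_majorant N x <= / v.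
Proof.
  intros N_pos v_le. apply Rinv_le_contravar; [lra|].
  assert (0 < / N) by now apply Rinv_0_lt_compat. lra.
Qed.

Lemma le_sin_majorant (N x a : R) : 0 < N -> a <= N -> a * Rabs (sin x) <= 1 ->
  a <= 2 * sin_majorant N x.
Proof.
  intros N_pos a_le a_sin_le.
  assert (0 < / N) by now apply Rinv_0_lt_compat.
  pose proof (Rabs_pos (sin x)).
  apply Rle_div_r; [lra|]. rewrite Rmult_plus_distr_l.
  assert (a * / N <= 1) by (apply Rle_div_l; lra). lra.
Qed.

Lemma sin_PI_ge (w : R) : 0 <= w <= 1 / 2 -> w <= sin (PI * w).
Proof.
  intros w_bounds.
  assert (PI_bounds : 3 < PI <= 4) by (pose proof PI2_3_2; pose proof PI_4; lra).
  assert (x_bounds : 3 * w <= PI * w <= 2) by nra.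
  destruct (pre_sin_bound (PI * w) 0) as [taylor_lower _]; [nra|lra|].
  unfold sin_approx, sin_term in taylor_lower; simpl in taylor_lower.
  set (x := PI * w) in *.
  assert (x * (x * x) <= 4 * x) by nra.
  lra.
Qed.

Lemma Rabs_sin_PI_shift (k : Z) (w : R) : Rabs (sin (PI * (IZR k + w))) = Rabs (sin (PI * w)).
Proof.
  assert (sin_kPI : sin (PI * IZR k) = 0) by (apply sin_eq_0_1; exists k; ring).
  assert (cos_kPI : Rabs (cos (PI * IZR k)) = 1).
  { pose proof (sin2_cos2 (PI * IZR k)) as pythagoras. rewrite sin_kPI in pythagoras.
    rewrite <- Rabs_R1; apply Rsqr_eq_abs_0; unfold Rsqr in *; lra. }
  rewrite Rmult_plus_distr_l, sin_plus, sin_kPI, Rmult_0_l, Rplus_0_l, Rabs_mult, cos_kPI; ring.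
Qed.

Lemma Rabs_sin_PI_ge (k : Z) (x : R) : 0 <= x - IZR k <= 1 ->
  Rmin (x - IZR k) (1 - (x - IZR k)) <= Rabs (sin (PI * x)).
Proof.
  intros x_bounds. replace x with (IZR k + (x - IZR k)) at 3 by ring. rewrite Rabs_sin_PI_shift.
  set (w := x - IZR k) in *.
  eapply Rle_trans; [|apply Rle_abs].
  destruct (Rle_lt_dec w (1 / 2)).
  - eapply Rle_trans; [apply Rmin_l|apply sin_PI_ge; lra].
  - eapply Rle_trans; [apply Rmin_r|].
    rewrite <- sin_PI_x. replace (PI - PI * w) with (PI * (1 - w)) by ring.
    apply sin_PI_ge; lra.
Qed.

Definition residue (b p : Z) (q r : nat) : nat :=
  Z.to_nat ((b + Z.of_nat r * p) mod Z.of_nat q).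

Lemma of_nat_residue (b p : Z) (q r : nat) : (0 < q)%nat ->
  Z.of_nat (residue b p q r) = ((b + Z.of_nat r * p) mod Z.of_nat q)%Z.
Proof. intros; apply Z2Nat.id, Z.mod_pos_bound; lia. Qed.

Lemma residue_lt (b p : Z) (q r : nat) : (0 < q)%nat -> (residue b p q r < q)%nat.
Proof.
  intros q_pos. pose proof (of_nat_residue b p q r q_pos).
  pose proof (Z.mod_pos_bound (b + Z.of_nat r * p) (Z.of_nat q) ltac:(lia)). lia.
Qed.

Lemma residue_inj (b p : Z) (q j k : nat) : reduced p q -> (j < q)%nat -> (k < q)%nat ->
  residue b p q j = residue b p q k -> j = k.
Proof.
  intros [q_pos coprime] j_lt k_lt eq_residue.
  apply (f_equal Z.of_nat) in eq_residue; rewrite !of_nat_residue in eq_residue by exact q_pos.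
  assert (divides : (Z.of_nat q | p * (Z.of_nat j - Z.of_nat k))%Z).
  { replace (p * (Z.of_nat j - Z.of_nat k))%Z
      with ((b + Z.of_nat j * p) - (b + Z.of_nat k * p))%Z by ring.
    apply Z.mod_divide; [lia|].
    now rewrite Zminus_mod, eq_residue, Z.sub_diag, Z.mod_0_l by lia. }
  apply Z.gauss in divides; [|now rewrite Z.gcd_comm].
  destruct divides as [c eq_c]. assert (c = 0)%Z by nia. subst; lia.
Qed.

Lemma sum_list_residue_le (f : nat -> R) (b p : Z) (q : nat) : reduced p q ->
  (forall u, 0 <= f u) ->
  sum_list (fun r => f (residue b p q r)) (seq 0 q) <= sum_list f (seq 0 q).
Proof.
  intros p_q_reduced f_ge0. rewrite <- (sum_list_map f).
  apply sum_list_incl; [exact f_ge0| |].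
  - apply Injective_map_NoDup_in; [|apply seq_NoDup].
    intros j k j_in k_in; apply in_seq in j_in, k_in; apply residue_inj; [assumption|lia|lia].
  - intros u u_in; apply in_map_iff in u_in; destruct u_in as (r & <- & _).
    apply in_seq; simpl. pose proof (residue_lt b p q r (proj1 p_q_reduced)). lia.
Qed.

Lemma fraction_near_residue (y : R) (p : Z) (q m0 : nat) : reduced p q ->
  Rabs (y - IZR p / INR q) <= / INR q ^ 2 ->
  exists b : Z, forall r : nat, (r <= q)%nat -> exists k : Z,
    -1 <= INR q * (INR (m0 + r) * y - IZR k) - INR (residue b p q r) <= 2.
Proof.
  intros p_q_reduced y_near. pose proof (reduced_INR_ge1 p q p_q_reduced) as q_ge1.
  set (b := Int_part (INR q * (INR m0 * y))).
  destruct (base_Int_part (INR q * (INR m0 * y))) as [b_le b_gt]; fold b in b_le, b_gt.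
  exists b; intros r r_le. exists ((b + Z.of_nat r * p) / Z.of_nat q)%Z.
  set (k := ((b + Z.of_nat r * p) / Z.of_nat q)%Z).
  assert (division : IZR b + INR r * IZR p = INR q * IZR k + INR (residue b p q r)).
  { destruct p_q_reduced as [q_pos _].
    rewrite !INR_IZR_INZ, of_nat_residue by exact q_pos.
    rewrite <- !mult_IZR, <- !plus_IZR. f_equal. apply Z.div_mod; lia. }
  assert (drift : Rabs (INR q * (INR r * (y - IZR p / INR q))) <= 1).
  { rewrite !Rabs_mult, !Rabs_pos_eq by apply pos_INR.
    assert (INR r <= INR q) by (apply le_INR; lia).
    apply Rle_trans with (INR q * (INR q * / INR q ^ 2)).
    - apply Rmult_le_compat_l; [lra|]. apply Rmult_le_compat; auto using pos_INR, Rabs_pos.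
    - right; field; lra. }
  apply Rabs_le_between in drift.
  replace (INR q * (INR (m0 + r) * y - IZR k) - INR (residue b p q r))
    with (INR q * (INR m0 * y) - IZR b + INR q * (INR r * (y - IZR p / INR q)));
    [lra|].
  replace (INR (residue b p q r)) with (IZR b + INR r * IZR p - INR q * IZR k) by lra.
  rewrite plus_INR; field; lra.
Qed.

(* Bounds [sin_majorant N (PI x)] when [x] is about [u / q] to the right of an integer. *)
Definition residue_weight (N : R) (q u : nat) : R :=
  if le_lt_dec u 1 then N else INR q / INR (u - 1).

Lemma residue_weight_ge0 (N : R) (q u : nat) : 0 < N -> 0 <= residue_weight N q u.
Proof.
  intros N_pos; unfold residue_weight; destruct le_lt_dec; [lra|].
  apply Rdiv_le_0_compat; [apply pos_INR|apply lt_0_INR; lia].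
Qed.

Lemma sum_residue_weight_le (N : R) (q : nat) : 0 < N ->
  sum_list (residue_weight N q) (seq 0 q) <= 2 * N + INR q * harmonic q.
Proof.
  intros N_pos. apply Rle_trans with (sum_list (residue_weight N q) (seq 0 (2 + q))).
  { apply sum_list_incl; [intros; now apply residue_weight_ge0|apply seq_NoDup|].
    intros u u_in; apply in_seq in u_in; apply in_seq; lia. }
  cbn [Nat.add seq]; rewrite !sum_list_cons, sum_list_seq_shift.
  rewrite (sum_list_ext _ (fun k => INR q * / INR k)).
  - rewrite sum_list_scal. unfold residue_weight at 1 2, harmonic; simpl le_lt_dec; cbn iota. lra.
  - intros k k_in; apply in_seq in k_in. unfold residue_weight.
    destruct le_lt_dec; [lia|]. now rewrite Nat.sub_succ, Nat.sub_0_r.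
Qed.

Lemma sin_majorant_le_residue_weight (N x : R) (k : Z) (q u : nat) : 0 < N ->
  -1 <= INR q * (x - IZR k) - INR u <= 2 ->
  sin_majorant N (PI * x) <= residue_weight N q u + residue_weight N q (q - 1 - u).
Proof.
  intros N_pos near.
  pose proof (sin_majorant_le N (PI * x) N_pos) as le_N.
  pose proof (residue_weight_ge0 N q u N_pos) as left_ge0.
  pose proof (residue_weight_ge0 N q (q - 1 - u) N_pos) as right_ge0.
  unfold residue_weight in *.
  destruct (le_lt_dec u 1) as [|u_gt1]; [lra|].
  destruct (le_lt_dec (q - 1 - u) 1) as [|u_lt_pred]; [lra|].
  assert (q_pos : 0 < INR q) by (apply lt_0_INR; lia).
  assert (v_pos : 0 < INR (u - 1)) by (apply lt_0_INR; lia).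
  assert (v'_pos : 0 < INR (q - 1 - u - 1)) by (apply lt_0_INR; lia).
  assert (left_gap : INR (u - 1) / INR q <= x - IZR k).
  { apply Rle_div_l; [lra|]. rewrite minus_INR by lia; simpl (INR 1); lra. }
  assert (right_gap : INR (q - 1 - u - 1) / INR q <= 1 - (x - IZR k)).
  { apply Rle_div_l; [lra|]. rewrite !minus_INR by lia; simpl (INR 1); lra. }
  assert (0 < INR (u - 1) / INR q) by now apply Rdiv_lt_0_compat.
  assert (0 < INR (q - 1 - u - 1) / INR q) by now apply Rdiv_lt_0_compat.
  rewrite <- (Rinv_div (INR (u - 1))) in *. rewrite <- (Rinv_div (INR (q - 1 - u - 1))) in *.
  pose proof (Rabs_sin_PI_ge k x ltac:(lra)) as sin_ge.
  unfold Rmin in sin_ge; destruct Rle_dec in sin_ge.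
  - pose proof (sin_majorant_le_inv N (PI * x) (INR (u - 1) / INR q) N_pos ltac:(lra)). lra.
  - pose proof (sin_majorant_le_inv N (PI * x) (INR (q - 1 - u - 1) / INR q) N_pos ltac:(lra)). lra.
Qed.

Lemma sum_sin_majorant_period_le (N y : R) (p : Z) (q m0 : nat) : 0 < N -> reduced p q ->
  Rabs (y - IZR p / INR q) <= / INR q ^ 2 ->
  sum_list (fun m => sin_majorant N (PI * (INR m * y))) (seq m0 q)
    <= 2 * (2 * N + INR q * harmonic q).
Proof.
  intros N_pos p_q_reduced y_near.
  destruct (fraction_near_residue y p q m0 p_q_reduced y_near) as [b near].
  pose proof (sum_residue_weight_le N q N_pos) as weights_le.
  apply Rle_trans with (sum_list (residue_weight N q) (seq 0 q)
    + sum_list (fun u => residue_weight N q (q - 1 - u)) (seq 0 q)).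
  2: { pose proof (sum_list_seq_rev (residue_weight N q) 0 q) as reversed.
    cbn [Nat.add] in reversed. lra. }
  assert (weight_ge0 : forall u, 0 <= residue_weight N q u)
    by (intros; now apply residue_weight_ge0).
  pose proof (sum_list_residue_le (residue_weight N q) b p q p_q_reduced weight_ge0).
  pose proof (sum_list_residue_le (fun u => residue_weight N q (q - 1 - u)) b p q p_q_reduced
    (fun u => weight_ge0 _)).
  eapply Rle_trans; [|apply Rplus_le_compat; eassumption].
  rewrite <- sum_list_plus.
  rewrite <- (Nat.add_0_r m0) at 1. rewrite <- map_add_seq, sum_list_map.
  apply sum_list_le; intros r r_in; apply in_seq in r_in.
  destruct (near r ltac:(lia)) as [k near_k].
  now apply sin_majorant_le_residue_weight with k.
Qed.

Lemma sum_sin_majorant_le (N y : R) (p : Z) (q n : nat) : 0 < N -> reduced p q ->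
  Rabs (y - IZR p / INR q) <= / INR q ^ 2 ->
  sum_list (fun m => sin_majorant N (PI * (INR m * y))) (seq 0 n)
    <= (INR n / INR q + 1) * (2 * (2 * N + INR q * harmonic q)).
Proof.
  intros N_pos p_q_reduced y_near.
  pose proof (reduced_INR_ge1 p q p_q_reduced) as q_ge1.
  set (bound := 2 * (2 * N + INR q * harmonic q)).
  assert (bound_ge0 : 0 <= bound).
  { pose proof (harmonic_ge1 q (proj1 p_q_reduced)). unfold bound; nra. }
  assert (periods_le : forall blocks,
    sum_list (fun m => sin_majorant N (PI * (INR m * y))) (seq 0 (blocks * q))
      <= INR blocks * bound).
  { induction blocks as [|blocks IH]; [unfold sum_list; simpl; lra|].
    replace (S blocks * q)%nat with (blocks * q + q)%nat by lia.
    rewrite seq_app, sum_list_app, S_INR, Rmult_plus_distr_r, Rmult_1_l.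
    apply Rplus_le_compat; [exact IH|].
    now apply sum_sin_majorant_period_le with p. }
  set (blocks := S (n / q)).
  assert (n_le : (n <= blocks * q)%nat).
  { unfold blocks. destruct p_q_reduced as [q_pos _].
    pose proof (Nat.div_mod_eq n q). pose proof (Nat.mod_upper_bound n q ltac:(lia)). nia. }
  assert (blocks_le : INR blocks <= INR n / INR q + 1).
  { unfold blocks; rewrite S_INR. apply Rplus_le_compat_r, Rle_div_r; [lra|].
    rewrite <- mult_INR; apply le_INR. rewrite Nat.mul_comm; apply Nat.Div0.mul_div_le. }
  apply Rle_trans with (INR blocks * bound); [|now apply Rmult_le_compat_r].
  eapply Rle_trans; [|apply periods_le].
  apply sum_list_incl; [intros; left; now apply sin_majorant_pos|apply seq_NoDup|].
  intros m m_in; apply in_seq in m_in; apply in_seq; lia.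
Qed.

Definition gauss_phase (y : R) (k : nat) : R := 2 * PI * INR k ^ 2 * y.

Definition gauss_sq (y : R) (n : nat) : R := expsum_sq (gauss_phase y) n.

Lemma gauss_correlation_le (y : R) (n l : nat) : (0 < n)%nat ->
  sum_list (fun k => cos (gauss_phase y (k + l) - gauss_phase y k)) (seq 1 (n - l))
    <= 2 * sin_majorant (INR n) (PI * (INR (2 * l) * y)).
Proof.
  intros n_pos. eapply Rle_trans; [apply Rle_abs|].
  apply le_sin_majorant; [now apply lt_0_INR| |].
  - eapply Rle_trans; [apply sum_cos_le_length|]. rewrite length_seq. apply le_INR; lia.
  - rewrite (sum_list_ext _
      (fun k => cos ((4 * PI * INR l * y) * INR k + 2 * PI * INR l ^ 2 * y))).
    2: { intros k _; f_equal; unfold gauss_phase; rewrite plus_INR; ring. }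
    replace (PI * (INR (2 * l) * y)) with ((4 * PI * INR l * y) / 2)
      by (rewrite mult_INR; simpl (INR 2); field).
    apply sum_cos_progression_le.
Qed.

Lemma weyl_inequality (y : R) (p : Z) (q n : nat) : (0 < n)%nat -> reduced p q ->
  Rabs (y - IZR p / INR q) <= / INR q ^ 2 ->
  gauss_sq y n <= 48 * harmonic q * (INR n ^ 2 / INR q + INR n + INR q).
Proof.
  intros n_pos p_q_reduced y_near.
  pose proof (INR_ge1 n n_pos) as n_ge1.
  pose proof (reduced_INR_ge1 p q p_q_reduced) as q_ge1.
  pose proof (harmonic_ge1 q (proj1 p_q_reduced)) as harmonic_q_ge1.
  assert (N_pos : 0 < INR n) by lra.
  set (majorant := fun m : nat => sin_majorant (INR n) (PI * (INR m * y))).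
  assert (even_frequencies : sum_list (fun l => majorant (2 * l)%nat) (seq 1 n)
    <= sum_list majorant (seq 0 (2 * n + 1))).
  { rewrite <- (sum_list_map majorant).
    apply sum_list_incl; [intros; left; now apply sin_majorant_pos| |].
    - apply Injective_map_NoDup; [intros j k; lia|apply seq_NoDup].
    - intros m m_in; apply in_map_iff in m_in; destruct m_in as (l & <- & l_in).
      apply in_seq in l_in; apply in_seq; lia. }
  pose proof (sum_sin_majorant_le (INR n) y p q (2 * n + 1) N_pos p_q_reduced y_near) as sum_le.
  fold majorant in sum_le.
  assert (correlations_le : gauss_sq y n
    <= INR n + 4 * sum_list (fun l => majorant (2 * l)%nat) (seq 1 n)).
  { unfold gauss_sq; rewrite expsum_sq_differencing.
    replace 4 with (2 * 2) by ring. rewrite Rmult_assoc.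
    apply Rplus_le_compat_l, Rmult_le_compat_l; [lra|]. rewrite <- sum_list_scal.
    apply sum_list_le; intros l _; now apply gauss_correlation_le. }
  rewrite plus_INR, mult_INR in sum_le; simpl (INR 2) in sum_le; simpl (INR 1) in sum_le.
  set (h := harmonic q) in *. set (N := INR n) in *. set (Q := INR q) in *.
  assert (((2 * N + 1) / Q + 1) * (2 * (2 * N + Q * h))
    <= (3 * N / Q + 1) * (2 * (2 * N + Q * h))).
  { apply Rmult_le_compat_r; [nra|]. apply Rplus_le_compat_r, Rmult_le_compat_r; [|lra].
    left; apply Rinv_0_lt_compat; lra. }
  assert (expanded : (3 * N / Q + 1) * (2 * (2 * N + Q * h))
    = 12 * (N ^ 2 / Q) + 6 * (h * N) + 4 * N + 2 * (h * Q)) by (field; lra).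
  assert (0 < N ^ 2 / Q) by (apply Rdiv_lt_0_compat; nra).
  assert (N ^ 2 / Q <= h * (N ^ 2 / Q)) by nra.
  assert (N <= h * N) by nra.
  assert (0 < h * Q) by nra.
  lra.
Qed.

Definition weyl_const (e : R) : R := 48 * (1 + / e).

Lemma weyl_const_pos (e : R) : 0 < e -> 0 < weyl_const e.
Proof. intros; assert (0 < / e) by now apply Rinv_0_lt_compat. unfold weyl_const; lra. Qed.

Lemma weyl_inequality_Rpower (e y : R) (p : Z) (q n : nat) : 0 < e -> (0 < n)%nat ->
  reduced p q -> Rabs (y - IZR p / INR q) <= / INR q ^ 2 ->
  gauss_sq y n <= weyl_const e * Rpower (INR q) e * (INR n ^ 2 / INR q + INR n + INR q).
Proof.
  intros e_pos n_pos p_q_reduced y_near.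
  eapply Rle_trans; [now apply (weyl_inequality y p q n)|].
  pose proof (reduced_INR_ge1 p q p_q_reduced).
  assert (0 < INR n) by now apply lt_0_INR.
  assert (0 < INR n ^ 2 / INR q) by (apply Rdiv_lt_0_compat; nra).
  pose proof (harmonic_le_Rpower e q e_pos).
  apply Rmult_le_compat_r; [lra|]. unfold weyl_const; lra.
Qed.

(** * Increments of phi *)

Lemma summation_by_parts (a b : nat -> R) (K n : nat) :
  sum_list (fun k => a k * b k) (seq (S K) n)
    = sum_list a (seq 1 (K + n)) * b (S (K + n)) - sum_list a (seq 1 K) * b (S K)
      + sum_list (fun k => sum_list a (seq 1 k) * (b k - b (S k))) (seq (S K) n).
Proof.
  induction n as [|n IH]; [rewrite Nat.add_0_r; unfold sum_list; simpl; ring|].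
  rewrite !(sum_list_seq_S _ (S K)), IH, Nat.add_succ_r; simpl (S K + n)%nat.
  rewrite (sum_list_seq_S a 1 (K + n)); simpl (1 + (K + n))%nat. ring.
Qed.

Lemma Rinv_sq_step_bounds (x : R) : 0 < x -> 0 <= / x ^ 2 - / (x + 1) ^ 2 <= 2 * / x ^ 3.
Proof.
  intros x_pos.
  replace (/ x ^ 2 - / (x + 1) ^ 2) with ((2 * x + 1) / (x ^ 2 * (x + 1) ^ 2)) by (field; lra).
  assert (0 < x ^ 2 * (x + 1) ^ 2) by (apply Rmult_lt_0_compat; apply pow_lt; lra).
  split; [apply Rdiv_le_0_compat; lra|].
  apply Rle_div_l; [assumption|].
  replace (2 * / x ^ 3 * (x ^ 2 * (x + 1) ^ 2)) with (2 * (x + 1) ^ 2 / x) by (field; lra).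
  apply Rle_div_r; nra.
Qed.

Lemma sum_over_squares_tail_le (a : nat -> R) (M gamma : R) (K n : nat) :
  gamma < 2 -> (0 < K)%nat -> 0 <= M ->
  (forall m, (K <= m)%nat -> Rabs (sum_list a (seq 1 m)) <= M * Rpower (INR m) gamma) ->
  Rabs (sum_list (fun k => a k / INR k ^ 2) (seq (S K) n))
    <= 2 * M * (1 + / (2 - gamma)) * Rpower (INR K) (gamma - 2).
Proof.
  intros gamma_lt2 K_pos M_ge0 sums_le.
  assert (pos : forall m, (K <= m)%nat -> 0 < INR m) by (intros; apply lt_0_INR; lia).
  assert (boundary_le : forall m, (K <= m)%nat ->
    Rabs (sum_list a (seq 1 m) * / INR (S m) ^ 2) <= M * Rpower (INR K) (gamma - 2)).
  { intros m K_le. pose proof (pos m K_le). pose proof (pos K (le_n K)).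
    assert (INR K <= INR m) by now apply le_INR.
    rewrite Rabs_mult, (Rabs_pos_eq (/ _)) by (left; apply Rinv_0_lt_compat, pow_lt, pos; lia).
    apply Rle_trans with (M * Rpower (INR m) gamma * Rpower (INR m) (- INR 2)).
    - apply Rmult_le_compat; [apply Rabs_pos| |now apply sums_le|].
      + left; apply Rinv_0_lt_compat, pow_lt, pos; lia.
      + rewrite Rpower_neg_INR by assumption.
        apply Rinv_le_contravar; [now apply pow_lt|]. rewrite S_INR; apply pow_incr; lra.
    - rewrite Rmult_assoc, <- Rpower_plus. apply Rmult_le_compat_l; [exact M_ge0|].
      apply Rpower_decr_base; simpl; lra. }
  assert (interior_le :
    Rabs (sum_list (fun k => sum_list a (seq 1 k) * (/ INR k ^ 2 - / INR (S k) ^ 2)) (seq (S K) n))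
      <= 2 * M * (/ (2 - gamma) * Rpower (INR K) (gamma - 2))).
  { eapply Rle_trans; [apply Rabs_sum_list|].
    replace (gamma - 2) with (- (2 - gamma)) by ring.
    eapply Rle_trans; [|apply Rmult_le_compat_l; [lra|apply (sum_Rpower_tail_le _ K n); [lra|lia]]].
    rewrite <- sum_list_scal; apply sum_list_le; intros k k_in; apply in_seq in k_in.
    pose proof (pos k ltac:(lia)) as k_pos.
    pose proof (Rinv_sq_step_bounds (INR k) k_pos) as step; rewrite <- S_INR in step.
    rewrite Rabs_mult, (Rabs_pos_eq (_ - _)) by lra.
    apply Rle_trans with (M * Rpower (INR k) gamma * (2 * Rpower (INR k) (- INR 3))).
    - rewrite Rpower_neg_INR by assumption.
      apply Rmult_le_compat; [apply Rabs_pos|lra|apply sums_le; lia|lra].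
    - replace (- 1 - (2 - gamma)) with (gamma + - INR 3) by (simpl; ring).
      rewrite Rpower_plus; right; ring. }
  rewrite (summation_by_parts a (fun k => / INR k ^ 2)).
  pose proof (boundary_le (K + n)%nat ltac:(lia)) as upper_boundary.
  pose proof (boundary_le K (le_n K)) as lower_boundary.
  apply Rabs_le_between in upper_boundary, lower_boundary, interior_le.
  apply Rabs_le; lra.
Qed.

Lemma Rabs_le_of_sq_le (x M : R) : 0 <= M -> x ^ 2 <= M ^ 2 -> Rabs x <= M.
Proof.
  intros M_ge0 sq_le. rewrite <- (Rabs_pos_eq M M_ge0).
  apply Rsqr_le_abs_0; unfold Rsqr; lra.
Qed.

Definition weyl_bounded (M e x : R) (n : nat) : Prop :=
  gauss_sq x n <= (M * Rpower (INR n) (1 + e)) ^ 2.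

Lemma gauss_cos_sum_le (M e x c : R) (n : nat) : 0 <= M -> weyl_bounded M e x n ->
  Rabs (sum_list (fun k => cos (gauss_phase x k + c)) (seq 1 n)) <= M * Rpower (INR n) (1 + e).
Proof.
  intros M_ge0 bounded. pose proof (Rpower_pos (INR n) (1 + e)).
  apply Rabs_le_of_sq_le; [nra|].
  eapply Rle_trans; [apply sum_cos_plus_sq_le|exact bounded].
Qed.

(* The phases [c = 0] and [c = - PI / 2] give the two components of [phi];
   differentiating in [y] adds [PI / 2] to the phase. *)
Definition gauss_term (y c : R) (k : nat) : R := cos (gauss_phase y k + c) / INR k ^ 2.

Definition gauss_series (y c : R) : R := Series (fun n => gauss_term y c (S n)).

Lemma ex_series_inv_sq : ex_series (fun n => / INR (S n) ^ 2).
Proof.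
  apply ex_series_ext with (fun n => Rpower (INR (S n)) (- 1 - 1)).
  - intros n. rewrite <- Rpower_neg_INR by (apply lt_0_INR; lia). f_equal; simpl; ring.
  - apply ex_series_Rpower; lra.
Qed.

Lemma ex_series_gauss_term (y c : R) : ex_series (fun n => gauss_term y c (S n)).
Proof.
  apply (ex_series_le (K := R_AbsRing) (V := R_CompleteNormedModule) _ (fun n => / INR (S n) ^ 2));
    [|exact ex_series_inv_sq].
  intros n; change (Rabs (gauss_term y c (S n)) <= / INR (S n) ^ 2).
  assert (0 < INR (S n) ^ 2) by (apply pow_lt, lt_0_INR; lia).
  unfold gauss_term. rewrite Rabs_div, (Rabs_pos_eq (INR _ ^ 2)) by lra.
  rewrite <- (Rmult_1_l (/ _)). apply Rmult_le_compat_r; [left; now apply Rinv_0_lt_compat|].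
  apply Rabs_le, COS_bound.
Qed.

Lemma Series_tail_le (a : nat -> R) (B : R) (K : nat) : ex_series a ->
  (forall n, Rabs (sum_list a (seq K n)) <= B) ->
  Rabs (Series a - sum_list a (seq 0 K)) <= B.
Proof.
  intros a_conv tails_le.
  assert (tail_lim : is_lim_seq (fun n => sum_n a n - sum_list a (seq 0 K))
    (Series a - sum_list a (seq 0 K))).
  { apply is_lim_seq_minus'; [now apply Series_correct|apply is_lim_seq_const]. }
  apply is_lim_seq_abs in tail_lim.
  apply (is_lim_seq_le_loc _ (fun _ => B) _ B) in tail_lim;
    [exact tail_lim| |apply is_lim_seq_const].
  exists K; intros n K_le. rewrite sum_n_sum_list.
  replace (S n) with (K + (S n - K))%nat by lia.
  rewrite seq_app, sum_list_app; simpl (0 + K)%nat.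
  replace (_ - _) with (sum_list a (seq K (S n - K))) by ring. apply tails_le.
Qed.

Lemma gauss_series_tail_le (M e y c : R) (K : nat) :
  0 <= M -> e <= 1 / 2 -> (0 < K)%nat ->
  (forall n, (K <= n)%nat -> weyl_bounded M e y n) ->
  Rabs (gauss_series y c - sum_list (gauss_term y c) (seq 1 K)) <= 6 * M * Rpower (INR K) (e - 1).
Proof.
  intros M_ge0 e_le K_pos bounded. unfold gauss_series.
  rewrite (sum_list_seq_shift (gauss_term y c)).
  apply Series_tail_le; [apply ex_series_gauss_term|]; intros n.
  rewrite <- (sum_list_seq_shift (gauss_term y c)).
  eapply Rle_trans; [apply (sum_over_squares_tail_le _ M (1 + e)); try assumption; [lra|]|].
  - intros m K_le; apply gauss_cos_sum_le; auto.
  - replace (1 + e - 2) with (e - 1) by ring.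
    apply Rmult_le_compat_r; [left; apply Rpower_pos|].
    assert (/ (2 - (1 + e)) <= 2).
    { rewrite <- (Rinv_inv 2). apply Rinv_le_contravar; lra. }
    nra.
Qed.

Lemma is_derive_gauss_term (x c : R) (k : nat) : (0 < k)%nat ->
  is_derive (fun y => gauss_term y c k) x (2 * PI * cos (gauss_phase x k + (c + PI / 2))).
Proof.
  intros k_pos. assert (0 < INR k) by now apply lt_0_INR.
  replace (gauss_phase x k + (c + PI / 2)) with (PI / 2 + (gauss_phase x k + c)) by ring.
  replace (cos (PI / 2 + (gauss_phase x k + c))) with (- sin (gauss_phase x k + c)).
  2: { rewrite cos_plus, cos_PI2, sin_PI2; ring. }
  unfold gauss_term, gauss_phase. auto_derive; [trivial|].
  change (INR k * (INR k * 1)) with (INR k ^ 2); field; lra.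
Qed.

Lemma gauss_partial_sum_increment_le (M e y v c : R) (K : nat) : 0 <= M ->
  (forall x, Rabs (x - y) <= Rabs v -> weyl_bounded M e x K) ->
  Rabs (sum_list (gauss_term (y + v) c) (seq 1 K) - sum_list (gauss_term y c) (seq 1 K))
    <= 2 * PI * (M * Rpower (INR K) (1 + e)) * Rabs v.
Proof.
  intros M_ge0 bounded. pose proof PI_RGT_0.
  replace (Rabs v) with (Rabs (y + v - y)) in * by (f_equal; ring).
  apply (bounded_variation (fun x => sum_list (gauss_term x c) (seq 1 K)) 
    (fun x => sum_list (fun k => 2 * PI * cos (gauss_phase x k + (c + PI / 2))) (seq 1 K))).
  intros x x_near; split.
  - apply (is_derive_sum_list (fun k y => gauss_term y c k)).
    intros k k_in; apply in_seq in k_in; apply is_derive_gauss_term; lia.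
  - rewrite sum_list_scal, Rabs_mult, Rabs_pos_eq by lra.
    apply Rmult_le_compat_l; [lra|]. apply gauss_cos_sum_le; auto.
Qed.

(* The mean value theorem controls the frequencies up to [K ~ |v|^(-1/2)],
   summation by parts those beyond. *)
Lemma gauss_series_increment_le (M e y v c : R) (K : nat) :
  0 <= M -> e <= 1 / 2 -> (0 < K)%nat -> Rabs v * INR K ^ 2 <= 4 ->
  (forall n x, (K <= n)%nat -> Rabs (x - y) <= Rabs v -> weyl_bounded M e x n) ->
  Rabs (gauss_series (y + v) c - gauss_series y c) <= 44 * M * Rpower (INR K) (e - 1).
Proof.
  intros M_ge0 e_le K_pos v_small bounded.
  assert (y_near : Rabs (y - y) <= Rabs v).
  { rewrite Rminus_diag, Rabs_R0; apply Rabs_pos. }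
  assert (yv_near : Rabs (y + v - y) <= Rabs v) by (right; f_equal; ring).
  pose proof (gauss_series_tail_le M e y c K M_ge0 e_le K_pos
    (fun n K_le => bounded n y K_le y_near)) as tail_y.
  pose proof (gauss_series_tail_le M e (y + v) c K M_ge0 e_le K_pos
    (fun n K_le => bounded n (y + v) K_le yv_near)) as tail_yv.
  pose proof (gauss_partial_sum_increment_le M e y v c K M_ge0
    (fun x => bounded K x (le_n K))) as head.
  assert (head_le :
    2 * PI * (M * Rpower (INR K) (1 + e)) * Rabs v <= 32 * M * Rpower (INR K) (e - 1)).
  { assert (K_R_pos : 0 < INR K) by now apply lt_0_INR.
    replace (1 + e) with (e - 1 + INR 2) by (simpl; ring).
    rewrite Rpower_plus, Rpower_pow by exact K_R_pos.
    pose proof (Rpower_pos (INR K) (e - 1)). pose proof PI_4. pose proof PI_RGT_0.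
    set (w := M * Rpower (INR K) (e - 1)).
    replace (2 * PI * (M * (Rpower (INR K) (e - 1) * INR K ^ 2)) * Rabs v)
      with (2 * (PI * (Rabs v * INR K ^ 2)) * w) by (unfold w; ring).
    replace (32 * M * Rpower (INR K) (e - 1)) with (32 * w) by (unfold w; ring).
    apply Rmult_le_compat_r; [unfold w; nra|].
    assert (0 <= Rabs v * INR K ^ 2) by (apply Rmult_le_pos; [apply Rabs_pos|apply pow2_ge_0]).
    nra. }
  apply Rabs_le_between in tail_y, tail_yv, head. apply Rabs_le; lra.
Qed.

Lemma phi_pair_gauss_term (n : nat) (t : R) :
  phi_pair n t = ((/ INR (S n) ^ 2 - gauss_term (2 * PI * t) 0 (S n)) / (2 * PI ^ 2),
                  gauss_term (2 * PI * t) (- (PI / 2)) (S n) / (2 * PI ^ 2)).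
Proof.
  assert (n_pos : 0 < INR (S n)) by (apply lt_0_INR; lia). pose proof PI_RGT_0.
  unfold phi_pair, phi_term, gauss_term, gauss_phase, Cminus, Cplus, Cmult, Copp, RtoC.
  cbn [fst snd].
  rewrite opp_IZR, <- INR_IZR_INZ.
  rewrite (cos_plus _ (- (PI / 2))), cos_neg, sin_neg, cos_PI2, sin_PI2, Rplus_0_r.
  replace (4 * PI ^ 2 * (- INR (S n)) ^ 2) with (4 * PI ^ 2 * INR (S n) ^ 2) by ring.
  replace (4 * PI ^ 2 * INR (S n) ^ 2 * t) with (2 * PI * INR (S n) ^ 2 * (2 * PI * t)) by ring.
  f_equal; field; lra.
Qed.

Lemma phi_gauss_series (t : R) :
  phi t = ((Series (fun n => / INR (S n) ^ 2) - gauss_series (2 * PI * t) 0) / (2 * PI ^ 2),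
           t + gauss_series (2 * PI * t) (- (PI / 2)) / (2 * PI ^ 2)).
Proof.
  unfold phi, Cplus; cbn [fst snd].
  rewrite (Series_ext _ (fun n =>
    (/ INR (S n) ^ 2 - gauss_term (2 * PI * t) 0 (S n)) * / (2 * PI ^ 2)))
    by (intros n; now rewrite phi_pair_gauss_term).
  rewrite (Series_ext (fun n => snd _) (fun n =>
    gauss_term (2 * PI * t) (- (PI / 2)) (S n) * / (2 * PI ^ 2)))
    by (intros n; now rewrite phi_pair_gauss_term).
  rewrite !Series_scal_r, Series_minus by (apply ex_series_inv_sq || apply ex_series_gauss_term).
  now rewrite Rplus_0_l.
Qed.

Lemma Cmod_le_sum (z : C) : Cmod z <= Rabs (fst z) + Rabs (snd z).
Proof.
  replace z with (Cplus (RtoC (fst z)) (Cmult Ci (RtoC (snd z)))) at 1.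
  - eapply Rle_trans; [apply Cmod_triangle|]. rewrite Cmod_mult, Cmod_Ci, !Cmod_R; lra.
  - destruct z as [x y]; unfold Cplus, Cmult, Ci, RtoC; simpl; f_equal; ring.
Qed.

Lemma phi_increment_le_at_cutoff (M e t h : R) (K : nat) :
  0 <= M -> e <= 1 / 2 -> (0 < K)%nat -> Rabs (2 * PI * h) * INR K ^ 2 <= 4 ->
  (forall n x, (K <= n)%nat -> Rabs (x - 2 * PI * t) <= Rabs (2 * PI * h) ->
     weyl_bounded M e x n) ->
  Cmod (Cminus (phi (t + h)) (phi t)) <= Rabs h + 6 * M * Rpower (INR K) (e - 1).
Proof.
  intros M_ge0 e_le K_pos h_small bounded.
  set (bound := M * Rpower (INR K) (e - 1)).
  assert (bound_ge0 : 0 <= bound) by (pose proof (Rpower_pos (INR K) (e - 1)); unfold bound; nra).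
  assert (increment : forall c,
    Rabs ((gauss_series (2 * PI * t + 2 * PI * h) c - gauss_series (2 * PI * t) c) / (2 * PI ^ 2))
      <= 3 * bound).
  { intros c. assert (PI > 3) by (pose proof PI2_3_2; lra).
    rewrite Rabs_div, (Rabs_pos_eq (2 * PI ^ 2)) by nra. apply Rle_div_l; [nra|].
    eapply Rle_trans; [now apply (gauss_series_increment_le M e _ _ c K)|].
    rewrite (Rmult_assoc 44); fold bound. assert (9 <= PI ^ 2) by nra. nra. }
  eapply Rle_trans; [apply Cmod_le_sum|].
  rewrite !phi_gauss_series, Rmult_plus_distr_l; unfold Cminus, Cplus, Copp; cbn [fst snd].
  pose proof (increment 0) as fst_le. pose proof (increment (- (PI / 2))) as snd_le.
  rewrite <- Rabs_Ropp in fst_le.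
  match goal with |- Rabs ?u + Rabs ?w <= _ =>
    replace u with (- ((gauss_series (2 * PI * t + 2 * PI * h) 0 - gauss_series (2 * PI * t) 0)
                        / (2 * PI ^ 2)))
      by (unfold Rdiv; ring);
    replace w with (h + (gauss_series (2 * PI * t + 2 * PI * h) (- (PI / 2))
                          - gauss_series (2 * PI * t) (- (PI / 2))) / (2 * PI ^ 2))
      by (unfold Rdiv; ring)
  end.
  pose proof (Rabs_triang h ((gauss_series (2 * PI * t + 2 * PI * h) (- (PI / 2))
    - gauss_series (2 * PI * t) (- (PI / 2))) / (2 * PI ^ 2))).
  unfold bound in *; lra.
Qed.

Lemma phi_increment_le (M e t h : R) :
  0 <= M -> e <= 1 / 2 -> 0 < Rabs (2 * PI * h) <= 1 ->
  (forall n x, 1 <= Rabs (2 * PI * h) * INR n ^ 2 ->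
     Rabs (x - 2 * PI * t) <= Rabs (2 * PI * h) -> weyl_bounded M e x n) ->
  Cmod (Cminus (phi (t + h)) (phi t))
    <= Rabs h + 6 * M * Rpower (Rabs (2 * PI * h)) ((1 - e) / 2).
Proof.
  intros M_ge0 e_le v_bounds bounded. set (v := Rabs (2 * PI * h)) in *.
  set (X := Rpower v (- (1 / 2))).
  assert (X_ge1 : 1 <= X).
  { rewrite <- (Rpower_1_l (- (1 / 2))) at 1. apply Rpower_decr_base; lra. }
  assert (X_scale : v * X ^ 2 = 1).
  { unfold X. rewrite Rpower_sqr. rewrite <- (Rpower_1 v) at 1 by lra.
    rewrite <- Rpower_plus. replace (1 + 2 * - (1 / 2)) with 0 by field. apply Rpower_O; lra. }
  destruct (nfloor_ex X ltac:(lra)) as [m [m_le m_gt]].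
  assert (K_bounds : X <= INR (S m) <= 2 * X) by (rewrite S_INR; lra).
  eapply Rle_trans; [apply (phi_increment_le_at_cutoff M e t h (S m)); auto; [lia| |]|].
  - fold v. assert (INR (S m) ^ 2 <= 4 * X ^ 2) by nra. nra.
  - intros n x n_ge x_near. apply bounded; [|exact x_near].
    rewrite <- X_scale. apply Rmult_le_compat_l; [lra|]. apply pow_incr.
    apply le_INR in n_ge; lra.
  - apply Rplus_le_compat_l, Rmult_le_compat_l; [lra|].
    apply Rle_trans with (Rpower X (e - 1)); [apply Rpower_decr_base; lra|].
    unfold X; rewrite Rpower_mult. right; f_equal; field.
Qed.

Lemma Rabs_le_Rabs_2PI (h : R) : Rabs h <= Rabs (2 * PI * h).
Proof.
  assert (PI > 3) by (pose proof PI2_3_2; lra).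
  rewrite Rabs_mult, (Rabs_pos_eq (2 * PI)) by lra. pose proof (Rabs_pos h). nra.
Qed.

Lemma weyl_bounded_near_rational (e x : R) (p : Z) (q n : nat) : 0 < e -> reduced p q ->
  Rabs (x - IZR p / INR q) <= / INR q ^ 2 -> INR q <= INR n ->
  weyl_bounded (sqrt (3 * weyl_const (2 * e)) * Rpower (INR q) (- (1 / 2))) e x n.
Proof.
  intros e_pos p_q_reduced x_near q_le_n.
  pose proof (reduced_INR_ge1 p q p_q_reduced) as q_ge1.
  pose proof (weyl_const_pos (2 * e) ltac:(lra)) as const_pos.
  assert (n_pos : (0 < n)%nat) by (apply INR_lt; simpl; lra).
  unfold weyl_bounded.
  eapply Rle_trans; [apply (weyl_inequality_Rpower (2 * e) x p q n); auto; lra|].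
  rewrite !Rpow_mult_distr, pow2_sqrt, !Rpower_sqr by lra.
  replace (2 * - (1 / 2)) with (- (1)) by field.
  replace (2 * (1 + e)) with (2 * e + INR 2) by (simpl; ring).
  rewrite Rpower_plus, Rpower_pow, Rpower_Ropp, Rpower_1 by lra.
  assert (INR n <= INR n ^ 2 / INR q) by (apply Rle_div_r; nra).
  replace (3 * weyl_const (2 * e) * / INR q * (Rpower (INR n) (2 * e) * INR n ^ 2))
    with (weyl_const (2 * e) * Rpower (INR n) (2 * e) * (3 * (INR n ^ 2 / INR q)))
    by (field; lra).
  pose proof (Rpower_pos (INR q) (2 * e)).
  apply Rmult_le_compat; [nra|lra| |lra].
  apply Rmult_le_compat_l; [lra|apply Rle_Rpower_l; lra].
Qed.

Definition near_rational_const (e : R) : R := 1 + 6 * sqrt (3 * weyl_const (2 * e)).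

Lemma near_rational_const_pos (e : R) : 0 < near_rational_const e.
Proof. pose proof (sqrt_pos (3 * weyl_const (2 * e))); unfold near_rational_const; lra. Qed.

Lemma denominator_le_frequency (q n rho : R) : 0 < q -> 0 <= n -> rho <= / q ^ 2 ->
  1 <= rho * n ^ 2 -> q <= n.
Proof.
  intros q_pos n_ge0 rho_le large.
  assert (1 <= / q ^ 2 * n ^ 2).
  { eapply Rle_trans; [exact large|]. apply Rmult_le_compat_r; [apply pow2_ge_0|exact rho_le]. }
  assert (q ^ 2 <= n ^ 2).
  { replace (n ^ 2) with (/ q ^ 2 * n ^ 2 * q ^ 2) by (field; lra). nra. }
  nra.
Qed.

Lemma le_near_rational_scale (e q rho : R) : 0 <= e -> 1 <= q -> 0 < rho <= / q ^ 2 ->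
  rho <= Rpower q (- (1 / 2)) * Rpower rho ((1 - e) / 2).
Proof.
  intros e_ge0 q_ge1 rho_bounds.
  assert (rho_le1 : rho <= 1).
  { eapply Rle_trans; [apply rho_bounds|]. rewrite <- Rinv_1; apply Rinv_le_contravar; nra. }
  rewrite <- (Rpower_1 rho) at 1 by lra. replace 1 with (1 / 2 + 1 / 2) at 1 by field.
  rewrite Rpower_plus.
  apply Rmult_le_compat; try (left; apply Rpower_pos); [|apply Rpower_decr_exponent; lra].
  apply Rle_trans with (Rpower (/ q ^ 2) (1 / 2)); [apply Rle_Rpower_l; lra|].
  rewrite <- Rpower_neg_INR, Rpower_mult by lra. apply Rle_Rpower; simpl; lra.
Qed.

Lemma phi_near_rational (e t0 t rho : R) (p : Z) (q : nat) :
  0 < e <= 1 / 2 -> reduced p q -> 2 * PI * t0 = IZR p / INR q -> 0 < rho <= / INR q ^ 2 ->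
  Rabs (2 * PI * t - IZR p / INR q) <= rho ->
  Cmod (Cminus (phi t) (phi t0))
    <= near_rational_const e * (Rpower (INR q) (- (1 / 2)) * Rpower rho ((1 - e) / 2)).
Proof.
  intros e_bounds p_q_reduced center rho_bounds t_near.
  pose proof (reduced_INR_ge1 p q p_q_reduced) as q_ge1.
  pose proof (le_near_rational_scale e (INR q) rho ltac:(lra) q_ge1 rho_bounds) as rho_le_scale.
  set (scale := Rpower (INR q) (- (1 / 2)) * Rpower rho ((1 - e) / 2)) in *.
  rewrite <- center, <- Rmult_minus_distr_l in t_near.
  replace t with (t0 + (t - t0)) at 1 by ring. set (h := t - t0) in *.
  destruct (Req_dec h 0) as [h_eq0|h_neq0].
  { rewrite h_eq0, Rplus_0_r. unfold Cminus; rewrite Cplus_opp_r, Cmod_0.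
    pose proof (near_rational_const_pos e); nra. }
  assert (v_pos : 0 < Rabs (2 * PI * h)).
  { apply Rabs_pos_lt; pose proof PI_RGT_0; apply Rmult_integral_contrapositive_currified; lra. }
  assert (v_le1 : Rabs (2 * PI * h) <= 1).
  { apply Rle_trans with (/ INR q ^ 2); [lra|]. rewrite <- Rinv_1; apply Rinv_le_contravar; nra. }
  eapply Rle_trans.
  { apply (phi_increment_le (sqrt (3 * weyl_const (2 * e)) * Rpower (INR q) (- (1 / 2))) e t0 h);
      try lra.
    - apply Rmult_le_pos; [apply sqrt_pos|left; apply Rpower_pos].
    - intros n x n_large x_near. apply (weyl_bounded_near_rational e x p q n); auto; try lra.
      + rewrite <- center; lra.
      + apply denominator_le_frequency with (Rabs (2 * PI * h)); try lra. apply pos_INR. }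
  pose proof (Rabs_le_Rabs_2PI h).
  assert (Rpower (INR q) (- (1 / 2)) * Rpower (Rabs (2 * PI * h)) ((1 - e) / 2) <= scale).
  { apply Rmult_le_compat_l; [left; apply Rpower_pos|apply Rle_Rpower_l; lra]. }
  pose proof (sqrt_pos (3 * weyl_const (2 * e))).
  unfold near_rational_const. nra.
Qed.

Lemma bounded_by_image_of_center (f : R -> C) (D : R -> Prop) (t0 d : R) :
  (forall t, D t -> Cmod (Cminus (f t) (f t0)) <= d) -> bounded_by (image f D) (2 * d).
Proof.
  intros near z z' (t & Dt & <-) (t' & Dt' & <-).
  replace (Cminus (f t) (f t'))
    with (Cplus (Cminus (f t) (f t0)) (Copp (Cminus (f t') (f t0)))) by ring.
  eapply Rle_trans; [apply Cmod_triangle|]. rewrite Cmod_opp.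
  pose proof (near t Dt). pose proof (near t' Dt'). lra.
Qed.

Lemma phi_arc_bounded_by (e rho : R) (p : Z) (q : nat) :
  0 < e <= 1 / 2 -> reduced p q -> 0 < rho <= / INR q ^ 2 ->
  bounded_by (image phi (fun t => Rabs (2 * PI * t - IZR p / INR q) <= rho))
    (2 * (near_rational_const e * (Rpower (INR q) (- (1 / 2)) * Rpower rho ((1 - e) / 2)))).
Proof.
  intros e_bounds p_q_reduced rho_bounds.
  apply bounded_by_image_of_center with (IZR p / INR q / (2 * PI)); intros t t_near.
  apply phi_near_rational with p; try assumption.
  pose proof PI_RGT_0. pose proof (reduced_INR_ge1 p q p_q_reduced). field; lra.
Qed.

Definition diophantine (mu c y : R) : Prop :=
  forall (p : Z) (q : nat), reduced p q -> c * Rpower (INR q) (- mu) <= Rabs (y - IZR p / INR q).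

Lemma Rpower_balance_le (c mu g G : R) : 0 < c <= 1 -> 2 <= mu -> 0 < G ->
  c * Rpower g mu <= Rpower G mu + g * Rpower G (mu - 1) -> g <= 2 / c * G.
Proof.
  intros c_bounds mu_ge2 G_pos balance.
  apply Rnot_lt_le; intros g_large.
  set (lambda := g / G). assert (g_eq : g = lambda * G) by (unfold lambda; field; lra).
  assert (c_lambda : 2 < c * lambda).
  { unfold lambda; replace (c * (g / G)) with (c * g / G) by (field; lra).
    apply Rlt_div_r; [lra|]. apply Rmult_lt_compat_l with (r := c) in g_large; [|lra].
    replace (c * (2 / c * G)) with (2 * G) in g_large by (field; lra). lra. }
  assert (lambda_gt2 : 2 < lambda) by nra.
  assert (lambda_sq : lambda ^ 2 <= Rpower lambda mu).
  { rewrite <- Rpower_pow by lra. apply Rle_Rpower; simpl; lra. }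
  assert (G_step : Rpower G mu = G * Rpower G (mu - 1)).
  { rewrite <- (Rpower_1 G) at 2 by lra. rewrite <- Rpower_plus; f_equal; ring. }
  rewrite g_eq, <- Rpower_mult_distr, Rmult_assoc, <- G_step in balance by lra.
  pose proof (Rpower_pos G mu).
  assert (c * Rpower lambda mu <= 1 + lambda).
  { apply Rmult_le_reg_r with (Rpower G mu); lra. }
  nra.
Qed.

Lemma le_dirichlet_scale (mu H n : R) : 2 <= mu -> 0 < H <= 1 -> 1 <= n -> 1 <= H * n ^ 2 ->
  n <= n ^ 2 * Rpower H (/ mu).
Proof.
  intros mu_ge2 H_bounds n_ge1 n_large. set (G := Rpower H (/ mu)).
  assert (G_pos : 0 < G) by apply Rpower_pos.
  assert (G_sq : H <= G ^ 2).
  { unfold G; rewrite Rpower_sqr, <- (Rpower_1 H) at 1 by lra.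
    apply Rpower_decr_exponent; [lra|]. apply Rle_div_l; lra. }
  assert (1 <= (n * G) ^ 2) by (rewrite Rpow_mult_distr; pose proof (pow2_ge_0 n); nra).
  assert (0 < n * G) by nra.
  assert (1 <= n * G) by (set (w := n * G) in *; nra).
  nra.
Qed.

Lemma diophantine_denominator_le (mu c x0 x H n : R) (p : Z) (q : nat) :
  0 < c <= 1 -> 2 <= mu -> diophantine mu c x0 -> 0 < H -> 1 <= H * n ^ 2 ->
  Rabs (x - x0) <= H -> reduced p q ->
  Rabs (x - IZR p / INR q) <= / (INR q * (n ^ 2 * Rpower H (/ mu))) ->
  / INR q <= 2 / c * Rpower H (/ mu).
Proof.
  intros c_bounds mu_ge2 x0_dio H_pos n_large x_near p_q_reduced x_approx.
  pose proof (reduced_INR_ge1 p q p_q_reduced) as q_ge1.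
  assert (q_inv_pos : 0 < / INR q) by (apply Rinv_0_lt_compat; lra).
  set (G := Rpower H (/ mu)) in *.
  assert (G_pos : 0 < G) by apply Rpower_pos.
  assert (G_mu : Rpower G mu = H).
  { unfold G; rewrite Rpower_mult, Rinv_l, Rpower_1 by lra; reflexivity. }
  apply (Rpower_balance_le c mu); try assumption.
  rewrite Rpower_inv_base, G_mu by lra.
  eapply Rle_trans; [apply (x0_dio p q p_q_reduced)|].
  replace (x0 - IZR p / INR q) with (- (x - x0) + (x - IZR p / INR q)) by ring.
  eapply Rle_trans; [apply Rabs_triang|]. rewrite Rabs_Ropp.
  apply Rplus_le_compat; [exact x_near|]. eapply Rle_trans; [exact x_approx|].
  rewrite Rinv_mult. apply Rmult_le_compat_l; [lra|].
  unfold Rminus; rewrite Rpower_plus, (Rpower_Ropp G 1), Rpower_1, G_mu by lra.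
  rewrite Rinv_mult. apply Rmult_le_compat_r; [left; now apply Rinv_0_lt_compat|].
  rewrite <- (Rmult_1_l (/ _)). apply Rle_div_l; nra.
Qed.

(* Dirichlet's theorem at the scale [X = n^2 H^(1/mu)]: both Weyl terms [n^2 / q] and [q]
   are then at most of the order of [X]. *)
Lemma weyl_bounded_diophantine (mu c e x0 x H : R) (n : nat) :
  0 < c <= 1 -> 2 <= mu -> 0 < e -> diophantine mu c x0 ->
  0 < H <= 1 -> 1 <= H * INR n ^ 2 -> Rabs (x - x0) <= H ->
  weyl_bounded (sqrt (weyl_const e * (2 / c + 2)) * Rpower H (/ (2 * mu))) e x n.
Proof.
  intros c_bounds mu_ge2 e_pos x0_dio H_bounds n_large x_near.
  assert (n_pos : (0 < n)%nat) by (destruct n; [simpl in n_large; lra|lia]).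
  pose proof (INR_ge1 n n_pos) as n_ge1.
  pose proof (weyl_const_pos e e_pos) as const_pos.
  assert (c_inv_pos : 0 < 2 / c) by (apply Rdiv_lt_0_compat; lra).
  pose proof (le_dirichlet_scale mu H (INR n) mu_ge2 H_bounds n_ge1 n_large) as n_le_X.
  set (X := INR n ^ 2 * Rpower H (/ mu)) in *.
  destruct (dirichlet x X ltac:(lra)) as (p & q & p_q_reduced & q_le_X & x_approx).
  pose proof (reduced_INR_ge1 p q p_q_reduced) as q_ge1.
  assert (q_inv_le : / INR q <= 2 / c * Rpower H (/ mu)).
  { apply (diophantine_denominator_le mu c x0 x H (INR n) p q); auto; lra. }
  unfold weyl_bounded.
  eapply Rle_trans; [apply (weyl_inequality_Rpower e x p q n); auto|].
  { eapply Rle_trans; [exact x_approx|]. apply Rinv_le_contravar; nra. }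
  rewrite !Rpow_mult_distr, pow2_sqrt, !Rpower_sqr by nra.
  replace (2 * / (2 * mu)) with (/ mu) by (field; lra).
  replace (2 * (1 + e)) with (2 * e + INR 2) by (simpl; ring).
  rewrite Rpower_plus, Rpower_pow by lra.
  replace (weyl_const e * (2 / c + 2) * Rpower H (/ mu) * (Rpower (INR n) (2 * e) * INR n ^ 2))
    with (weyl_const e * Rpower (INR n) (2 * e) * (2 / c * X + X + X)) by (unfold X; ring).
  pose proof (Rpower_pos (INR q) e).
  assert (INR n ^ 2 / INR q <= 2 / c * X).
  { unfold X, Rdiv in *. pose proof (pow2_ge_0 (INR n)). nra. }
  assert (0 < INR n ^ 2 / INR q) by (apply Rdiv_lt_0_compat; nra).
  assert (X_le : X <= INR n ^ 2).
  { pose proof (Rpower_le1 H (/ mu) H_bounds ltac:(left; apply Rinv_0_lt_compat; lra)).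
    unfold X; nra. }
  apply Rmult_le_compat; [nra|lra| |lra].
  apply Rmult_le_compat_l; [lra|].
  apply Rle_trans with (Rpower (INR n ^ 2) e); [apply Rle_Rpower_l; lra|].
  rewrite <- Rpower_pow, Rpower_mult by lra. right; f_equal; simpl; ring.
Qed.

Lemma phi_increment_diophantine (mu c e t : R) :
  0 < c <= 1 -> 2 <= mu -> 0 < e <= 1 / 2 -> diophantine mu c (2 * PI * t) ->
  exists C0, 0 < C0 /\ forall h, 0 < Rabs (2 * PI * h) <= 1 ->
    Cmod (Cminus (phi (t + h)) (phi t))
      <= C0 * Rpower (Rabs (2 * PI * h)) (1 / 2 + / (2 * mu) - e / 2).
Proof.
  intros c_bounds mu_ge2 e_bounds t_dio.
  set (A := sqrt (weyl_const e * (2 / c + 2))).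
  assert (A_ge0 : 0 <= A) by apply sqrt_pos.
  exists (1 + 6 * A); split; [lra|]; intros h v_bounds.
  set (v := Rabs (2 * PI * h)) in *.
  assert (mu_inv_bounds : 0 < / (2 * mu) <= / 4).
  { split; [apply Rinv_0_lt_compat|apply Rinv_le_contravar]; lra. }
  eapply Rle_trans.
  { apply (phi_increment_le (A * Rpower v (/ (2 * mu))) e t h); fold v; try lra.
    - apply Rmult_le_pos; [lra|left; apply Rpower_pos].
    - intros n x n_large x_near.
      apply (weyl_bounded_diophantine mu c e (2 * PI * t)); auto; lra. }
  fold v.
  assert (linear_term : Rabs h <= Rpower v (1 / 2 + / (2 * mu) - e / 2)).
  { apply Rle_trans with v; [apply Rabs_le_Rabs_2PI|].
    rewrite <- (Rpower_1 v) at 1 by lra. apply Rpower_decr_exponent; lra. }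
  replace (1 / 2 + / (2 * mu) - e / 2) with (/ (2 * mu) + (1 - e) / 2) in * by (field; lra).
  rewrite Rpower_plus in *. lra.
Qed.

(** * Hausdorff null sets *)

Lemma rpow_pos_eq (x b : R) : 0 < x -> rpow x b = Rpower x b.
Proof. intros; unfold rpow; now destruct (Rlt_dec 0 x). Qed.

Lemma rpow_0_l (b : R) : 0 < b -> rpow 0 b = 0.
Proof.
  intros; unfold rpow. destruct (Rlt_dec 0 0); [lra|].
  destruct (Req_EM_T b 0); [lra|reflexivity].
Qed.

Lemma rpow_ge0 (x b : R) : 0 <= rpow x b.
Proof.
  unfold rpow. destruct (Rlt_dec 0 x); [left; apply Rpower_pos|].
  destruct (Req_EM_T b 0); lra.
Qed.

Lemma rpow_le_inv (x y b : R) : 0 < b -> 0 < y -> rpow x b <= Rpower y b -> x <= y.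
Proof.
  intros b_pos y_pos pow_le. apply Rnot_lt_le; intros y_lt.
  rewrite rpow_pos_eq in pow_le by lra.
  assert (Rpower y b < Rpower x b); [apply Rlt_Rpower_l|]; lra.
Qed.

Lemma diam_pow_ge0 (U : C -> Prop) (s : R) : 0 <= diam_pow U s.
Proof. unfold diam_pow; destruct Rlt_dec; [left; apply Rpower_pos|lra]. Qed.

Lemma diam_le (U : C -> Prop) (d : R) : 0 <= d -> bounded_by U d -> diam U <= d.
Proof.
  intros d_ge0 U_bounded. unfold diam.
  match goal with |- real (Lub_Rbar ?E) <= d =>
    assert (lub_le : Rbar_le (Lub_Rbar E) d) end.
  { apply Lub_Rbar_correct. intros r [-> | (x & y & Ux & Uy & ->)]; simpl; [exact d_ge0|].
    now apply U_bounded. }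
  destruct (Lub_Rbar _); simpl in *; try contradiction; assumption.
Qed.

Lemma diam_pow_le (U : C -> Prop) (d s : R) : 0 < s -> 0 <= d -> bounded_by U d ->
  diam_pow U s <= rpow d s.
Proof.
  intros s_pos d_ge0 U_bounded. pose proof (diam_le U d d_ge0 U_bounded).
  unfold diam_pow; destruct Rlt_dec; [|apply rpow_ge0].
  rewrite rpow_pos_eq by lra. apply Rle_Rpower_l; lra.
Qed.

Definition hausdorff_covered (s E : R) (A : C -> Prop) : Prop :=
  exists (U : nat -> C -> Prop) (d : nat -> R),
    (forall i, 0 <= d i) /\ (forall i, bounded_by (U i) (d i)) /\
    (forall z, A z -> exists i, U i z) /\
    (forall n, sum_list (fun i => rpow (d i) s) (seq 0 n) <= E).

Definition hausdorff_null (s : R) (A : C -> Prop) : Prop :=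
  forall E, 0 < E -> hausdorff_covered s E A.

Lemma hausdorff_covered_double (s E : R) (A : C -> Prop) (U : nat -> nat -> C -> Prop)
    (d : nat -> nat -> R) (g : nat -> R) :
  (forall i j, 0 <= d i j) -> (forall i j, bounded_by (U i j) (d i j)) ->
  (forall z, A z -> exists i j, U i j z) ->
  (forall i n, sum_list (fun j => rpow (d i j) s) (seq 0 n) <= g i) ->
  (forall n, sum_list g (seq 0 n) <= E) -> hausdorff_covered s E A.
Proof.
  intros d_ge0 U_bounded A_covered row_le col_le.
  exists (fun n => U (fst (Cantor.of_nat n)) (snd (Cantor.of_nat n))),
    (fun n => d (fst (Cantor.of_nat n)) (snd (Cantor.of_nat n))).
  repeat split; auto.
  - intros z Az; destruct (A_covered z Az) as (i & j & Uz).
    exists (Cantor.to_nat (i, j)). rewrite Cantor.cancel_of_to; exact Uz.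
  - apply (sum_list_Cantor_le (fun i j => rpow (d i j) s) g E); auto.
    intros; apply rpow_ge0.
Qed.

Lemma hausdorff_null_incl (s : R) (A B : C -> Prop) : (forall z, A z -> B z) ->
  hausdorff_null s B -> hausdorff_null s A.
Proof.
  intros A_incl B_null E E_pos. destruct (B_null E E_pos) as (U & d & ? & ? & ? & ?).
  exists U, d; repeat split; auto.
Qed.

Lemma sum_half_pow_le (n : nat) : sum_list (fun i => (1 / 2) ^ S i) (seq 0 n) <= 1.
Proof.
  assert (closed_form : sum_list (fun i => (1 / 2) ^ S i) (seq 0 n) = 1 - (1 / 2) ^ n).
  { induction n as [|n IH]; [unfold sum_list; simpl; ring|].
    rewrite sum_list_seq_S, IH; simpl; field. }
  assert (0 < (1 / 2) ^ n) by (apply pow_lt; lra). lra.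
Qed.

Lemma hausdorff_null_union (s : R) (A : nat -> C -> Prop) :
  (forall i, hausdorff_null s (A i)) -> hausdorff_null s (fun z => exists i, A i z).
Proof.
  intros A_null E E_pos.
  set (g := fun i : nat => E * (1 / 2) ^ S i).
  assert (g_pos : forall i, 0 < g i).
  { intros i; apply Rmult_lt_0_compat; [exact E_pos|apply pow_lt; lra]. }
  destruct (functional_choice (fun i Ud =>
      (forall j, 0 <= snd Ud j) /\ (forall j, bounded_by (fst Ud j) (snd Ud j)) /\
      (forall z, A i z -> exists j, fst Ud j z) /\
      (forall n, sum_list (fun j => rpow (snd Ud j) s) (seq 0 n) <= g i)))
    as [Ud Ud_cover].
  { intros i. destruct (A_null i (g i) (g_pos i)) as (U & d & cover). exists (U, d); exact cover. }
  apply (hausdorff_covered_double s E _ (fun i => fst (Ud i)) (fun i => snd (Ud i)) g);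
    try (intros i; apply Ud_cover).
  - intros z [i Az]; exists i; now apply Ud_cover.
  - intros n; unfold g; rewrite sum_list_scal. pose proof (sum_half_pow_le n). nra.
Qed.

Lemma hausdorff_null_union_Z (s : R) (A : Z -> C -> Prop) :
  (forall m, hausdorff_null s (A m)) -> hausdorff_null s (fun z => exists m, A m z).
Proof.
  intros A_null.
  apply hausdorff_null_incl with (fun z => exists i j : nat, A (Z.of_nat i - Z.of_nat j)%Z z).
  - intros z [m Az]; exists (Z.to_nat m), (Z.to_nat (- m)).
    now replace (Z.of_nat (Z.to_nat m) - Z.of_nat (Z.to_nat (- m)))%Z with m by lia.
  - apply hausdorff_null_union; intros i; apply hausdorff_null_union; intros j; apply A_null.
Qed.

Lemma hausdorff_null_or (s : R) (A B : C -> Prop) :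
  hausdorff_null s A -> hausdorff_null s B -> hausdorff_null s (fun z => A z \/ B z).
Proof.
  intros A_null B_null.
  apply hausdorff_null_incl with (fun z => exists i : nat, (match i with O => A | _ => B end) z).
  - intros z [Az|Bz]; [exists 0%nat|exists 1%nat]; assumption.
  - apply hausdorff_null_union; intros [|i]; assumption.
Qed.

Lemma hausdorff_null_subsingleton (s : R) (A : C -> Prop) :
  0 < s -> bounded_by A 0 -> hausdorff_null s A.
Proof.
  intros s_pos A_point E E_pos. exists (fun _ => A), (fun _ => 0).
  split; [intros; lra|]. split; [auto|]. split; [intros z Az; now exists 0%nat|].
  intros n; rewrite sum_list_const, rpow_0_l by exact s_pos. lra.
Qed.

Lemma ex_series_tail_le (a : nat -> R) (E : R) : ex_series a -> 0 < E ->
  exists Q, forall n, sum_list a (seq Q n) <= E.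
Proof.
  intros [l a_sum] E_pos.
  assert (half_pos : 0 < E / 2) by lra.
  destruct (proj2 (is_lim_seq_spec (sum_n a) l) a_sum (mkposreal _ half_pos)) as [Q near_l].
  exists (S Q); intros n.
  pose proof (near_l Q (le_n Q)) as near_Q. pose proof (near_l (Q + n)%nat ltac:(lia)) as near_Qn.
  rewrite sum_n_sum_list in near_Q, near_Qn.
  change (S (Q + n)) with (S Q + n)%nat in near_Qn. rewrite seq_app, sum_list_app in near_Qn.
  cbn [pos Nat.add] in near_Q, near_Qn. apply Rabs_lt_between in near_Q, near_Qn. lra.
Qed.

Lemma hausdorff_cantelli (s : R) (A : C -> Prop) (U : nat -> nat -> C -> Prop)
    (d : nat -> R) (count : nat -> nat) :
  0 < s -> (forall q, 0 <= d q) -> (forall q i, bounded_by (U q i) (d q)) ->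
  ex_series (fun q => INR (count q) * rpow (d q) s) ->
  (forall z, A z -> forall Q, exists q i, (Q <= q)%nat /\ (i < count q)%nat /\ U q i z) ->
  hausdorff_null s A.
Proof.
  intros s_pos d_ge0 U_bounded conv A_limsup E E_pos.
  destruct (ex_series_tail_le _ E conv E_pos) as [Q tail_le].
  apply (hausdorff_covered_double s E A
    (fun k i z => (i < count (Q + k))%nat /\ U (Q + k)%nat i z)
    (fun k i => if i <? count (Q + k)%nat then d (Q + k)%nat else 0)
    (fun k => INR (count (Q + k)%nat) * rpow (d (Q + k)%nat) s)).
  - intros k i; destruct (_ <? _); [apply d_ge0|lra].
  - intros k i z z' [i_lt Uz] [_ Uz']. apply Nat.ltb_lt in i_lt; rewrite i_lt.
    now apply U_bounded with i.
  - intros z Az; destruct (A_limsup z Az Q) as (q & i & Q_le & i_lt & Uz).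
    exists (q - Q)%nat, i. now replace (Q + (q - Q))%nat with q by lia.
  - intros k n.
    rewrite (sum_list_ext _ (fun i =>
      if i <? count (Q + k)%nat then rpow (d (Q + k)%nat) s else 0)).
    + apply sum_list_seq_ltb_le, rpow_ge0.
    + intros i _; destruct (_ <? _); [reflexivity|now apply rpow_0_l].
  - intros n.
    rewrite <- (sum_list_map (fun q => INR (count q) * rpow (d q) s) (fun k => Q + k)%nat).
    rewrite map_add_seq, Nat.add_0_r. apply tail_le.
Qed.

Lemma Rbar_le_of_forall_gt (x : Rbar) (b : R) : (forall E, b < E -> Rbar_le x E) -> Rbar_le x b.
Proof.
  intros le_above. destruct x as [r| |]; simpl in *; [|apply (le_above (b + 1)); lra|trivial].
  apply Rnot_lt_le; intros b_lt. specialize (le_above ((r + b) / 2) ltac:(lra)). lra.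
Qed.

Lemma hausdorff_pre_ge0 (s delta : R) (A : C -> Prop) : Rbar_le 0 (hausdorff_pre s delta A).
Proof.
  unfold hausdorff_pre. apply Glb_Rbar_correct. intros r (U & _ & _ & sum_r).
  apply (is_lim_seq_le (fun _ => 0) (sum_n (fun i => diam_pow (U i) s)) 0 r).
  - intros n; rewrite sum_n_sum_list. apply sum_list_ge0; intros; apply diam_pow_ge0.
  - apply is_lim_seq_const.
  - exact sum_r.
Qed.

Lemma hausdorff_measure_eq0 (s : R) (A : C -> Prop) :
  (forall n : nat, Rbar_le (hausdorff_pre s (/ INR (S n)) A) 0) ->
  hausdorff_measure s A = Finite 0.
Proof.
  intros pre_le0. unfold hausdorff_measure.
  rewrite (Sup_seq_ext _ (fun _ => Finite 0)).
  - apply is_sup_seq_unique. intros [eps eps_pos]; split.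
    + intros n; simpl; lra.
    + exists 0%nat; simpl; lra.
  - intros n; apply Rbar_le_antisym; [apply pre_le0|apply hausdorff_pre_ge0].
Qed.

Lemma hausdorff_pre_le (s delta E : R) (A : C -> Prop) : 0 < s -> 0 < delta ->
  E <= Rpower delta s -> hausdorff_covered s E A -> Rbar_le (hausdorff_pre s delta A) E.
Proof.
  intros s_pos delta_pos E_le (U & d & d_ge0 & U_bounded & A_covered & sum_le).
  assert (d_le : forall i, d i <= delta).
  { intros i. apply rpow_le_inv with s; [exact s_pos|exact delta_pos|].
    eapply Rle_trans; [|exact E_le]. eapply Rle_trans; [|apply (sum_le (S i))].
    rewrite sum_list_seq_S; simpl (0 + i)%nat.
    pose proof (sum_list_ge0 (fun i => rpow (d i) s) (seq 0 i) (fun k => rpow_ge0 (d k) s)). lra. }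
  assert (diam_sum_le : forall n, sum_list (fun i => diam_pow (U i) s) (seq 0 n) <= E).
  { intros n; eapply Rle_trans; [|apply (sum_le n)].
    apply sum_list_le; intros i _; now apply diam_pow_le. }
  destruct (ex_series_bounded (fun i => diam_pow (U i) s) E) as [r sum_r];
    [intros; apply diam_pow_ge0|exact diam_sum_le|].
  apply Rbar_le_trans with (Finite r).
  - apply Glb_Rbar_correct. exists U. split; [|split; [exact A_covered|exact sum_r]].
    intros i x y Ux Uy. eapply Rle_trans; [apply (U_bounded i x y Ux Uy)|apply d_le].
  - apply (is_lim_seq_le (sum_n (fun i => diam_pow (U i) s)) (fun _ => E) r E).
    + intros n; rewrite sum_n_sum_list; apply diam_sum_le.
    + exact sum_r.
    + apply is_lim_seq_const.
Qed.

Lemma hausdorff_null_measure (s : R) (A : C -> Prop) : 0 < s -> hausdorff_null s A ->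
  hausdorff_measure s A = Finite 0.
Proof.
  intros s_pos A_null. apply hausdorff_measure_eq0; intros n.
  set (delta := / INR (S n)).
  assert (delta_pos : 0 < delta) by (apply Rinv_0_lt_compat, lt_0_INR; lia).
  apply Rbar_le_of_forall_gt; intros E E_pos.
  apply Rbar_le_trans with (Finite (Rmin E (Rpower delta s))); [|apply Rmin_l].
  apply hausdorff_pre_le; [exact s_pos|exact delta_pos|apply Rmin_r|].
  apply A_null, Rmin_pos; [exact E_pos|apply Rpower_pos].
Qed.

Lemma hausdorff_pre_incl (s delta : R) (A B : C -> Prop) : (forall z, A z -> B z) ->
  Rbar_le (hausdorff_pre s delta A) (hausdorff_pre s delta B).
Proof.
  intros A_incl. apply Glb_Rbar_correct; intros r (U & U_bounded & B_covered & sum_r).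
  apply Glb_Rbar_correct; exists U; auto.
Qed.

Lemma hausdorff_dim_incl (A B : C -> Prop) : (forall z, A z -> B z) ->
  Rbar_le (hausdorff_dim A) (hausdorff_dim B).
Proof.
  intros A_incl. apply Glb_Rbar_correct; intros s [s_pos B_null].
  apply Glb_Rbar_correct; split; [exact s_pos|].
  apply hausdorff_measure_eq0; intros n.
  eapply Rbar_le_trans; [apply hausdorff_pre_incl, A_incl|].
  rewrite <- B_null.
  apply (is_sup_seq_major (fun n => hausdorff_pre s (/ INR (S n)) B)), Sup_seq_correct.
Qed.

Lemma hausdorff_dim_le (A : C -> Prop) (b : R) : 0 <= b ->
  (forall s, b < s -> hausdorff_null s A) -> Rbar_le (hausdorff_dim A) b.
Proof.
  intros b_ge0 A_null. apply Rbar_le_of_forall_gt; intros s b_lt.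
  apply Glb_Rbar_correct; split; [lra|].
  apply hausdorff_null_measure; [lra|now apply A_null].
Qed.

(** * Diophantine approximation and the covering of the image *)

Definition is_rational (y : R) : Prop :=
  exists (p : Z) (q : nat), (0 < q)%nat /\ y = IZR p / INR q.

Definition well_approximable (mu y : R) : Prop :=
  forall Q : nat, exists (p : Z) (q : nat), (Q <= q)%nat /\ reduced p q /\
    Rabs (y - IZR p / INR q) <= Rpower (INR q) (- mu).

Lemma hausdorff_null_image_rational (f : R -> C) (s : R) : 0 < s ->
  hausdorff_null s (image f (fun t => is_rational (2 * PI * t))).
Proof.
  intros s_pos.
  apply hausdorff_null_incl with (fun z => exists (p : Z) (q : nat),
    image f (fun t => 2 * PI * t = IZR p / INR q) z).
  - intros z (t & (p & q & _ & t_eq) & z_eq). exists p, q, t; auto.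
  - apply hausdorff_null_union_Z; intros p; apply hausdorff_null_union; intros q.
    apply hausdorff_null_subsingleton; [exact s_pos|].
    intros z z' (t & t_eq & <-) (t' & t'_eq & <-).
    assert (t = t').
    { pose proof PI_RGT_0. apply Rmult_eq_reg_l with (2 * PI); [congruence|lra]. }
    subst; unfold Cminus; rewrite Cplus_opp_r, Cmod_0; lra.
Qed.

Definition arc_diam (mu e q : R) : R :=
  2 * near_rational_const e * Rpower q (- ((1 + mu - mu * e) / 2)).

Lemma arc_diam_pos (mu e q : R) : 0 < arc_diam mu e q.
Proof.
  pose proof (near_rational_const_pos e). unfold arc_diam.
  apply Rmult_lt_0_compat; [lra|apply Rpower_pos].
Qed.

Lemma phi_arc_bounded_by_arc_diam (mu e : R) (p : Z) (q : nat) :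
  0 < e <= 1 / 2 -> 2 <= mu -> reduced p q ->
  bounded_by (image phi (fun t => Rabs (2 * PI * t - IZR p / INR q) <= Rpower (INR q) (- mu)))
    (arc_diam mu e (INR q)).
Proof.
  intros e_bounds mu_ge2 p_q_reduced.
  pose proof (reduced_INR_ge1 p q p_q_reduced) as q_ge1.
  replace (arc_diam mu e (INR q)) with (2 * (near_rational_const e *
    (Rpower (INR q) (- (1 / 2)) * Rpower (Rpower (INR q) (- mu)) ((1 - e) / 2)))).
  - apply phi_arc_bounded_by; [exact e_bounds|exact p_q_reduced|].
    split; [apply Rpower_pos|].
    rewrite <- Rpower_neg_INR by lra. apply Rle_Rpower; simpl; lra.
  - unfold arc_diam. rewrite Rpower_mult, <- Rpower_plus, Rmult_assoc.
    do 3 f_equal; field.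
Qed.

Lemma ex_series_arc_diam (mu e s : R) : 4 < s * (1 + mu - mu * e) ->
  ex_series (fun q => INR (q + 3) * rpow (arc_diam mu e (INR q)) s).
Proof.
  intros s_large.
  set (tau := s * (1 + mu - mu * e) / 2 - 2). assert (tau_pos : 0 < tau) by (unfold tau; lra).
  set (B := Rpower (2 * near_rational_const e) s).
  apply ex_series_incr_1.
  apply (ex_series_le (K := R_AbsRing) (V := R_CompleteNormedModule) _
    (fun n => 4 * B * Rpower (INR (S n)) (- 1 - tau))).
  2: { apply (ex_series_scal_l (K := R_AbsRing) (4 * B)
         (fun n => Rpower (INR (S n)) (- 1 - tau))).
       now apply ex_series_Rpower. }
  intros n. change (Rabs (INR (S n + 3) * rpow (arc_diam mu e (INR (S n))) s)
    <= 4 * B * Rpower (INR (S n)) (- 1 - tau)).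
  rewrite Rabs_pos_eq by (apply Rmult_le_pos; [apply pos_INR|apply rpow_ge0]).
  assert (q_ge1 : 1 <= INR (S n)) by (apply INR_ge1; lia).
  set (q := INR (S n)) in *.
  rewrite rpow_pos_eq by apply arc_diam_pos. unfold arc_diam.
  pose proof (near_rational_const_pos e).
  rewrite <- Rpower_mult_distr by (try apply Rpower_pos; lra). fold B.
  rewrite Rpower_mult, plus_INR; fold q.
  replace (- ((1 + mu - mu * e) / 2) * s) with (- (1) + (- 1 - tau)) by (unfold tau; field).
  rewrite Rpower_plus, Rpower_Ropp, Rpower_1 by lra.
  apply Rle_trans with (4 * q * (B * (/ q * Rpower q (- 1 - tau)))).
  - apply Rmult_le_compat_r; [|simpl (INR 3); lra].
    repeat apply Rmult_le_pos; try (left; apply Rpower_pos). left; apply Rinv_0_lt_compat; lra.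
  - right; field; lra.
Qed.

Lemma numerator_range (mu y : R) (p : Z) (q : nat) : 1 <= mu -> (0 < q)%nat ->
  Rabs (y - IZR p / INR q) <= Rpower (INR q) (- mu) ->
  exists i : nat, (i < q + 3)%nat /\ (p = Int_part y * Z.of_nat q - 1 + Z.of_nat i)%Z.
Proof.
  intros mu_ge1 q_pos y_near. pose proof (INR_ge1 q q_pos) as q_ge1.
  assert (dist_le1 : Rabs (y * INR q - IZR p) <= 1).
  { rewrite Rabs_minus_fraction in y_near by lra. apply Rle_div_l in y_near; [|lra].
    eapply Rle_trans; [exact y_near|].
    apply Rle_trans with (Rpower (INR q) (- (1)) * INR q).
    - apply Rmult_le_compat_r; [lra|apply Rle_Rpower; lra].
    - rewrite Rpower_Ropp, Rpower_1 by lra. right; field; lra. }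
  apply Rabs_le_between in dist_le1.
  destruct (base_Int_part y) as [floor_le floor_gt]. set (m := Int_part y) in *.
  assert (lower : (m * Z.of_nat q - 1 <= p)%Z).
  { apply le_IZR. rewrite minus_IZR, mult_IZR, <- INR_IZR_INZ. nra. }
  assert (upper : (p <= m * Z.of_nat q + Z.of_nat q + 1)%Z).
  { apply le_IZR. rewrite !plus_IZR, mult_IZR, <- INR_IZR_INZ. nra. }
  exists (Z.to_nat (p - (m * Z.of_nat q - 1))); lia.
Qed.

Lemma exponent_loss (s mu : R) : 0 < s -> 0 < mu -> 4 < s * (1 + mu) ->
  exists e, 0 < e <= 1 / 2 /\ 4 < s * (1 + mu - mu * e).
Proof.
  intros s_pos mu_pos s_large. assert (0 < s * mu) by nra.
  set (slack := (s * (1 + mu) - 4) / (2 * (s * mu))).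
  assert (slack_pos : 0 < slack) by (apply Rdiv_lt_0_compat; lra).
  assert (slack_eq : 2 * (s * mu) * slack = s * (1 + mu) - 4) by (unfold slack; field; lra).
  exists (Rmin (1 / 2) slack).
  pose proof (Rmin_l (1 / 2) slack). pose proof (Rmin_r (1 / 2) slack).
  split; [split; [apply Rmin_pos; lra|assumption]|]. nra.
Qed.

Lemma hausdorff_null_image_well_approximable_unit (s mu : R) (m : Z) :
  0 < s -> 2 <= mu -> 4 < s * (1 + mu) ->
  hausdorff_null s
    (image phi (fun t => well_approximable mu (2 * PI * t) /\ Int_part (2 * PI * t) = m)).
Proof.
  intros s_pos mu_ge2 s_large.
  destruct (exponent_loss s mu s_pos ltac:(lra) s_large) as (e & e_bounds & s_large_e).
  set (p := fun q i : nat => (m * Z.of_nat q - 1 + Z.of_nat i)%Z).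
  apply (hausdorff_cantelli s _
    (fun q i z => reduced (p q i) q /\
      image phi (fun t => Rabs (2 * PI * t - IZR (p q i) / INR q) <= Rpower (INR q) (- mu)) z)
    (fun q => arc_diam mu e (INR q)) (fun q => q + 3)%nat).
  - exact s_pos.
  - intros q; left; apply arc_diam_pos.
  - intros q i z z' [p_q_reduced z_in] [_ z'_in].
    now apply (phi_arc_bounded_by_arc_diam mu e (p q i) q).
  - now apply ex_series_arc_diam.
  - intros z (t & (t_approx & t_floor) & z_eq) Q.
    destruct (t_approx Q) as (p' & q & Q_le & p_q_reduced & t_near).
    destruct (numerator_range mu (2 * PI * t) p' q) as (i & i_lt & p'_eq);
      [lra|apply p_q_reduced|exact t_near|].
    rewrite t_floor in p'_eq; change (p' = p q i) in p'_eq; subst p'.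
    exists q, i; repeat split; try assumption; [apply p_q_reduced..|]. exists t; auto.
Qed.

Lemma hausdorff_null_image_well_approximable (s mu : R) : 0 < s -> 2 <= mu -> 4 < s * (1 + mu) ->
  hausdorff_null s (image phi (fun t => well_approximable mu (2 * PI * t))).
Proof.
  intros s_pos mu_ge2 s_large.
  apply hausdorff_null_incl with (fun z => exists m : Z,
    image phi (fun t => well_approximable mu (2 * PI * t) /\ Int_part (2 * PI * t) = m) z).
  - intros z (t & t_approx & z_eq). exists (Int_part (2 * PI * t)), t; auto.
  - apply hausdorff_null_union_Z; intros m; now apply hausdorff_null_image_well_approximable_unit.
Qed.

Lemma irrational_gap_denominator (y : R) (q : nat) : ~ is_rational y -> (0 < q)%nat ->
  exists c, 0 < c /\ forall p : Z, c <= Rabs (y - IZR p / INR q).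
Proof.
  intros y_irrational q_pos. assert (q_R_pos : 0 < INR q) by now apply lt_0_INR.
  set (b := Int_part (y * INR q)).
  destruct (base_Int_part (y * INR q)) as [floor_le floor_gt]; fold b in floor_le, floor_gt.
  assert (not_floor : IZR b <> y * INR q).
  { intros b_eq; apply y_irrational. exists b, q; split; [exact q_pos|]. rewrite b_eq; field; lra. }
  set (gap := Rmin (y * INR q - IZR b) (IZR b + 1 - y * INR q)).
  assert (gap_pos : 0 < gap) by (apply Rmin_pos; lra).
  exists (gap / INR q); split; [now apply Rdiv_lt_0_compat|]; intros p.
  rewrite Rabs_minus_fraction by exact q_R_pos.
  apply Rmult_le_compat_r; [left; now apply Rinv_0_lt_compat|].
  destruct (Z_le_gt_dec p b) as [p_le|p_gt].
  - apply IZR_le in p_le. rewrite Rabs_pos_eq by lra.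
    eapply Rle_trans; [apply Rmin_l|]; lra.
  - assert (b_succ_le : (b + 1 <= p)%Z) by lia. apply IZR_le in b_succ_le.
    rewrite plus_IZR in b_succ_le.
    rewrite Rabs_left1 by lra. eapply Rle_trans; [apply Rmin_r|]; lra.
Qed.

Lemma irrational_gap (y : R) (Q : nat) : ~ is_rational y ->
  exists c, 0 < c <= 1 /\ forall (p : Z) (q : nat), (0 < q < Q)%nat ->
    c <= Rabs (y - IZR p / INR q).
Proof.
  intros y_irrational. induction Q as [|Q (c & c_bounds & IH)].
  { exists 1; split; [lra|lia]. }
  destruct (Nat.eq_0_gt_0_cases Q) as [->|Q_pos].
  { exists 1; split; [lra|lia]. }
  destruct (irrational_gap_denominator y Q y_irrational Q_pos) as (c' & c'_pos & gap_Q).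
  exists (Rmin c c'); split.
  { split; [apply Rmin_pos; lra|]. eapply Rle_trans; [apply Rmin_l|lra]. }
  intros p q q_range. destruct (Nat.eq_dec q Q) as [->|q_neq].
  - eapply Rle_trans; [apply Rmin_r|apply gap_Q].
  - eapply Rle_trans; [apply Rmin_l|apply IH; lia].
Qed.

Lemma irrational_well_approximable_2 (y : R) : ~ is_rational y -> well_approximable 2 y.
Proof.
  intros y_irrational Q. destruct (irrational_gap y Q y_irrational) as (c & c_bounds & gap).
  assert (c_inv_ge1 : 1 <= / c) by (rewrite <- Rinv_1; apply Rinv_le_contravar; lra).
  destruct (dirichlet y (/ c + 1) ltac:(lra)) as (p & q & p_q_reduced & q_le & y_near).
  pose proof (reduced_INR_ge1 p q p_q_reduced) as q_ge1.
  exists p, q; split; [|split; [exact p_q_reduced|]].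
  - destruct (le_lt_dec Q q) as [Q_le|q_lt]; [exact Q_le|exfalso].
    specialize (gap p q (conj (proj1 p_q_reduced) q_lt)).
    assert (/ (INR q * (/ c + 1)) < c); [|lra].
    rewrite <- (Rinv_inv c) at 2. apply Rinv_lt_contravar; nra.
  - change (- (2)) with (- INR 2). rewrite Rpower_neg_INR by lra.
    eapply Rle_trans; [exact y_near|]. apply Rinv_le_contravar; nra.
Qed.

Lemma not_well_approximable_diophantine (mu y : R) : 0 <= mu -> ~ is_rational y ->
  ~ well_approximable mu y -> exists c, 0 < c <= 1 /\ diophantine mu c y.
Proof.
  intros mu_ge0 y_irrational not_approx.
  apply not_all_ex_not in not_approx; destruct not_approx as [Q far_beyond_Q].
  destruct (irrational_gap y Q y_irrational) as (c & c_bounds & gap).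
  exists c; split; [exact c_bounds|]. intros p q p_q_reduced.
  pose proof (reduced_INR_ge1 p q p_q_reduced) as q_ge1.
  pose proof (Rpower_pos (INR q) (- mu)).
  destruct (le_lt_dec Q q) as [Q_le|q_lt].
  - apply Rle_trans with (Rpower (INR q) (- mu)); [nra|].
    apply Rnot_lt_le; intros near. apply far_beyond_Q.
    exists p, q; repeat split; try apply p_q_reduced; [exact Q_le|lra].
  - apply Rle_trans with c; [|apply gap; split; [apply p_q_reduced|exact q_lt]].
    assert (Rpower (INR q) (- mu) <= 1); [|nra].
    rewrite <- (Rpower_O (INR q)) by lra. apply Rle_Rpower; lra.
Qed.

Lemma holder_at_of_increment_le (f : R -> C) (x0 beta K delta : R) :
  0 < beta -> 0 < K -> 0 < delta ->
  (forall h, 0 < Rabs h < delta -> Cmod (Cminus (f (x0 + h)) (f x0)) <= K * Rpower (Rabs h) beta) ->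
  holder_at f x0 beta.
Proof.
  intros beta_pos K_pos delta_pos increment_le.
  exists 0%nat, (fun _ => f x0), K, delta.
  split; [simpl; lra|]. split; [exact K_pos|]. split; [exact delta_pos|].
  intros h h_lt; simpl cpoly. destruct (Req_dec h 0) as [->|h_neq0].
  - rewrite Rplus_0_r, Rabs_R0, rpow_0_l by exact beta_pos.
    unfold Cminus; rewrite Cplus_opp_r, Cmod_0; lra.
  - pose proof (Rabs_pos_lt h h_neq0). rewrite rpow_pos_eq by assumption.
    now apply increment_le.
Qed.

Lemma holder_at_le_exponent (f : R -> C) (x0 beta : R) : 0 <= beta -> holder_at f x0 beta ->
  Rbar_le beta (holder_exponent f x0).
Proof. intros; now apply (proj1 (Lub_Rbar_correct _) beta). Qed.

Lemma phi_holder_at_diophantine (mu c beta t : R) : 0 < c <= 1 -> 2 <= mu ->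
  diophantine mu c (2 * PI * t) -> 0 < beta < 1 / 2 + / (2 * mu) -> holder_at phi t beta.
Proof.
  intros c_bounds mu_ge2 t_dio beta_bounds.
  set (margin := 1 / 2 + / (2 * mu) - beta).
  set (e := Rmin (1 / 2) (2 * margin)).
  assert (e_bounds : 0 < e <= 1 / 2).
  { split; [apply Rmin_pos; unfold margin; lra|apply Rmin_l]. }
  assert (e_le : e <= 2 * margin) by apply Rmin_r. unfold margin in e_le.
  destruct (phi_increment_diophantine mu c e t c_bounds mu_ge2 e_bounds t_dio)
    as (C0 & C0_pos & increment_le).
  pose proof PI_RGT_0.
  apply holder_at_of_increment_le with (C0 * Rpower (2 * PI) beta) (/ (2 * PI)).
  - lra.
  - apply Rmult_lt_0_compat; [exact C0_pos|apply Rpower_pos].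
  - apply Rinv_0_lt_compat; lra.
  - intros h h_bounds.
    assert (v_eq : Rabs (2 * PI * h) = 2 * PI * Rabs h)
      by (rewrite Rabs_mult, (Rabs_pos_eq (2 * PI)); lra).
    assert (v_bounds : 0 < Rabs (2 * PI * h) <= 1).
    { rewrite v_eq; split; [apply Rmult_lt_0_compat; lra|].
      replace 1 with (2 * PI * / (2 * PI)) by (field; lra). apply Rmult_le_compat_l; lra. }
    eapply Rle_trans; [now apply increment_le|].
    rewrite (Rmult_assoc C0), Rpower_mult_distr, <- v_eq by lra.
    apply Rmult_le_compat_l; [lra|]. apply Rpower_decr_exponent; lra.
Qed.

Lemma D_below_well_approximable (alpha mu t : R) : 1 / 2 <= alpha < 1 / 2 + / (2 * mu) -> 2 <= mu ->
  D_below alpha t -> ~ is_rational (2 * PI * t) -> well_approximable mu (2 * PI * t).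
Proof.
  intros alpha_bounds mu_ge2 (sigma & _ & sigma_le & exponent_eq) t_irrational.
  apply NNPP; intros not_approx.
  destruct (not_well_approximable_diophantine mu (2 * PI * t)) as (c & c_bounds & t_dio);
    [lra|exact t_irrational|exact not_approx|].
  set (beta := (alpha + (1 / 2 + / (2 * mu))) / 2).
  assert (beta_bounds : alpha < beta < 1 / 2 + / (2 * mu)) by (unfold beta; lra).
  pose proof (phi_holder_at_diophantine mu c beta t c_bounds mu_ge2 t_dio ltac:(lra)) as phi_holder.
  apply holder_at_le_exponent in phi_holder; [|lra].
  rewrite exponent_eq in phi_holder; simpl in phi_holder; lra.
Qed.

(* With [a = 2 alpha - 1], the requirements are [2 <= mu], [4 / s - 1 < mu] and [a mu < 1];
   [mu = m + (1 - a m)] slightly overshoots the maximum [m] of the two lower bounds. *)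
Lemma approximation_exponent_exists (alpha s : R) : 1 / 2 <= alpha < 3 / 4 ->
  (4 * alpha - 2) / alpha < s ->
  exists mu, 2 <= mu /\ 4 < s * (1 + mu) /\ alpha < 1 / 2 + / (2 * mu).
Proof.
  intros alpha_bounds s_gt. apply Rlt_div_l in s_gt; [|lra].
  assert (s_pos : 0 < s) by nra.
  set (a := 2 * alpha - 1). set (b := 4 / s - 1). set (m := Rmax 2 b).
  assert (s_b : s * (1 + b) = 4) by (unfold b; field; lra).
  assert (a_bounds : 0 <= a < 1 / 2) by (unfold a; lra).
  assert (a_b_lt1 : a * b < 1).
  { apply Rmult_lt_reg_l with s; [exact s_pos|].
    replace (s * (a * b)) with (a * (s * (1 + b)) - a * s) by ring.
    rewrite s_b; unfold a; lra. }
  assert (a_m_lt1 : a * m < 1) by (unfold m, Rmax; destruct Rle_dec; lra).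
  assert (m_ge2 : 2 <= m) by apply Rmax_l.
  assert (b_le_m : b <= m) by apply Rmax_r.
  set (mu := m + (1 - a * m)).
  assert (mu_gt : m < mu) by (unfold mu; lra).
  exists mu; split; [lra|]; split; [nra|].
  assert (a * mu < 1) by (unfold mu; nra).
  assert (alpha - 1 / 2 < / (2 * mu)); [|lra].
  rewrite <- (Rmult_1_l (/ _)). apply Rlt_div_r; [lra|]. unfold a in *; lra.
Qed.

Lemma D_below_covering_exponent (alpha s : R) : 1 / 2 <= alpha <= 3 / 4 ->
  (4 * alpha - 2) / alpha < s ->
  exists mu, 2 <= mu /\ 4 < s * (1 + mu) /\
    forall t, D_below alpha t -> ~ is_rational (2 * PI * t) -> well_approximable mu (2 * PI * t).
Proof.
  intros alpha_bounds s_gt. destruct (Rlt_le_dec alpha (3 / 4)) as [alpha_lt|alpha_ge].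
  - destruct (approximation_exponent_exists alpha s) as (mu & mu_ge2 & s_large & alpha_lt_mu);
      [lra|exact s_gt|].
    exists mu; repeat split; auto. intros t; apply D_below_well_approximable; lra.
  - exists 2; split; [lra|]; split.
    + replace alpha with (3 / 4) in s_gt by lra. lra.
    + intros t _; apply irrational_well_approximable_2.
Qed.

Lemma hausdorff_null_image_D_below (alpha s : R) : 1 / 2 <= alpha <= 3 / 4 ->
  (4 * alpha - 2) / alpha < s -> hausdorff_null s (image phi (D_below alpha)).
Proof.
  intros alpha_bounds s_gt.
  assert (s_pos : 0 < s).
  { eapply Rle_lt_trans; [|exact s_gt]. apply Rdiv_le_0_compat; lra. }
  destruct (D_below_covering_exponent alpha s alpha_bounds s_gt)
    as (mu & mu_ge2 & s_large & well_approx).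
  apply hausdorff_null_incl with (fun z =>
    image phi (fun t => is_rational (2 * PI * t)) z \/
    image phi (fun t => well_approximable mu (2 * PI * t)) z).
  - intros z (t & t_below & z_eq).
    destruct (classic (is_rational (2 * PI * t))); [left|right]; exists t; auto.
  - apply hausdorff_null_or;
      [now apply hausdorff_null_image_rational|now apply hausdorff_null_image_well_approximable].
Qed.

Theorem theorem1p2 : forall alpha : R, 1/2 <= alpha <= 3/4 ->
  Rbar_le (hausdorff_dim (image phi (D_level alpha)))
          (hausdorff_dim (image phi (D_below alpha))) /\
  Rbar_le (hausdorff_dim (image phi (D_below alpha)))
          (Finite ((4 * alpha - 2) / alpha)).
Proof.
  intros alpha alpha_bounds; split.
  - apply hausdorff_dim_incl. intros z (t & t_level & z_eq). exists t; split; [|exact z_eq].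
    exists alpha; repeat split; [lra|lra|exact t_level].
  - apply hausdorff_dim_le; [apply Rdiv_le_0_compat; lra|].
    intros s s_gt; now apply hausdorff_null_image_D_below.
Qed.
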